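(* Let the channel vectors $h_i$ ($i\in\mathcal K_I$), $g_j$ ($j\in\mathcal K_E$) be random and satisfy the channel assumption stated in the context. Then with probability one the following holds: if the standing (non-trivial case) assumption of the context is satisfied, then the optimal solution $(\{W_i^*\}_{i\in\mathcal K_I},W_E^* )$ of the semidefinite program (SDR2) $$\max_{\{W_i\},W_E}\ \sum_{i\in\mathcal K_I}\mathrm{tr}(GW_i)+\mathrm{tr}(GW_E)$$ subject to $$\frac{\mathrm{tr}(h_i^Hh_iW_i)}{\gamma_i}-\sum_{k\ne i,\,k\in\mathcal K_I}\mathrm{tr}(h_i^Hh_iW_k)-\sigma_i^2\ge 0\quad\forall i\in\mathcal K_I,$$ $$\sum_{i\in\mathcal K_I}\mathrm{tr}(W_i)+\mathrm{tr}(W_E)\le P,\qquad W_i\succeq 0\ \forall i\in\mathcal K_I,\quad W_E\succeq 0$$ (over Hermitian $M\times M$ matrices) satisfies $\mathrm{rank}(W_i^* )=1$ for all $i\in\mathcal K_I$ and $\mathrm{rank}(W_E^* )\le1$; furthermore $W_E^*=q^*v_Ev_E^H$ for some $0\le q^*\le P$.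
   Context: Setting. $M>1$ is an integer, $\mathcal K_I=\{1,\dots,K_I\}$, $\mathcal K_E=\{1,\dots,K_E\}$ with $K_I,K_E\ge1$. $h_i\in\mathbb C^{1\times M}$ ($i\in\mathcal K_I$) and $g_j\in\mathbb C^{1\times M}$ ($j\in\mathcal K_E$) are row vectors. The constants are $P>0$, $\sigma_i^2>0$, $\gamma_i>0$ ($i\in\mathcal K_I$), $\alpha_j\ge0$ ($j\in\mathcal K_E$), $0<\zeta\le1$. Put $G=\zeta\sum_{j\in\mathcal K_E}\alpha_jg_j^Hg_j\succeq0$; $\xi_E$ denotes the largest (dominant) eigenvalue of $G$ and $v_E\in\mathbb C^{M\times1}$ the corresponding unit-norm eigenvector. Channel assumption (independently distributed user channels). The vectors $h_i$, $g_j$ are independently drawn from continuous distributions $f_{h_i}$, $f_{g_j}$. Moreover, for any $d\times M$ matrix $F$ with $0<d\le M$ whose $d$ rows form any subset of the channel vectors $\{h_i\}\cup\{g_j\}$, it holds with probability one that (i) $\mathrm{rank}(F)=d$, and (ii) the ordered nonzero singular values of $F$ are strictly decreasing, $\tau_1>\cdots>\tau_d>0$. Standing (non-trivial case) assumption. (a) Feasibility: there exist $w_i\in\mathbb C^{M\times1}$, $i\in\mathcal K_I$, with $\dfrac{|h_iw_i|^2}{\sum_{k\ne i}|h_iw_k|^2+\sigma_i^2}\ge\gamma_i$ for all $i\in\mathcal K_I$ and $\sum_i\|w_i\|^2\le P$. (b) Aligning all beams with $v_E$ is infeasible: there is no $\{p_i\ge0\}_{i\in\mathcal K_I}$ with $\sum_ip_i\le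 P$ and $\dfrac{p_i|h_iv_E|^2}{\sum_{k\ne i}p_k|h_iv_E|^2+\sigma_i^2}\ge\gamma_i$ for all $i\in\mathcal K_I$.
   Formalization: At least one weight α_j is assumed positive; if all α_j = 0 then G = 0, v_E is not determined, every feasible point is optimal, and the rank claims fail (e.g. W_1 = (P/2)I with M = 2, K_I = 1 and P large). *)

(* Defs.v *)
From HB Require Import structures.
From mathcomp Require Import all_boot all_order all_algebra.
From mathcomp Require Import complex.
From mathcomp Require Import all_classical all_reals all_analysis.

Set Implicit Arguments.
Unset Strict Implicit.
Unset Printing Implicit Defensive.

Import Order.TTheory GRing.Theory Num.Theory.

Local Open Scope classical_set_scope.
Local Open Scope ring_scope.
Local Open Scope complex_scope.
Local Open Scope sesquilinear_scope.

(* [g] and its two hypotheses play no role in the value of the measure; they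
   are arguments only so that sigma-finiteness can be inferred. *)
Section prod_image.
Context d1 d2 d3 (T1 : measurableType d1) (T2 : measurableType d2)
  (T3 : measurableType d3) (R : realType).
Context (m1 : {sigma_finite_measure set T1 -> \bar R})
  (m2 : {sigma_finite_measure set T2 -> \bar R}).
Context (f : T1 * T2 -> T3) (g : T3 -> T1 * T2)
  (mf : measurable_fun setT f) (mg : measurable_fun setT g) (fK : cancel f g).

Definition prod_image of measurable_fun setT f & measurable_fun setT g
    & cancel f g : set T3 -> \bar R :=
  pushforward (m1 \x m2)%E f.

Local Notation m := (prod_image mf mg fK).

Let mpre A : measurable A -> measurable (f @^-1` A).
Proof. by move=> mA; rewrite -[X in measurable X]setTI; exact: mf. Qed.

Let prod_image0 : m set0 = 0%E.
Proof. by rewrite /m /pushforward preimage_set0 measure0. Qed.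

Let prod_image_ge0 A : (0 <= m A)%E.
Proof. exact: (measure_ge0 (m1 \x m2)%E). Qed.

Let prod_image_sigma_additive : semi_sigma_additive m.
Proof.
move=> F mF tF mUF; rewrite /prod_image /pushforward preimage_bigcup.
apply: measure_semi_sigma_additive.
- by move=> k; exact: mpre.
- apply/trivIsetP => /= i j _ _ ij; rewrite -preimage_setI.
  by move/trivIsetP : tF => /(_ _ _ _ _ ij) ->//; rewrite preimage_set0.
- by rewrite -preimage_bigcup; exact: mpre.
Qed.

HB.instance Definition _ := isMeasure.Build _ _ _ m
  prod_image0 prod_image_ge0 prod_image_sigma_additive.

Let prod_image_sigma_finite : sigma_finite setT m.
Proof.
have /sigma_finiteP[F [FT ndF Foo]] := sigma_finiteT m1.
have /sigma_finiteP[G [GT ndG Goo]] := sigma_finiteT m2.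
exists (fun k => g @^-1` (F k `*` G k)).
  rewrite -preimage_bigcup (_ : \bigcup_k _ = setT) ?preimage_setT//.
  apply/seteqP; split=> // -[x y] _.
  have [i _ Fx] : (\bigcup_k F k) x by rewrite -FT.
  have [j _ Gy] : (\bigcup_k G k) y by rewrite -GT.
  exists (maxn i j) => //; split=> /=.
    by move: x Fx; exact/subsetPset/ndF/leq_maxl.
  by move: y Gy; exact/subsetPset/ndG/leq_maxr.
move=> k; have [mF Fk] := Foo k; have [mG Gk] := Goo k; split.
  by rewrite -[X in measurable X]setTI; apply: mg => //; exact: measurableX.
rewrite /prod_image /pushforward -comp_preimage.
rewrite (_ : g \o f = id) ?preimage_id; last exact/funext/fK.
by rewrite product_measure1E// lte_mul_pinfty// ge0_fin_numE.
Qed.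

HB.instance Definition _ := Measure_isSigmaFinite.Build _ _ _ m
  prod_image_sigma_finite.

End prod_image.

Section lebesgue_tuple.
Context {R : realType}.
Local Notation mR := (measurableTypeR R).

Definition tuple_cons n (p : mR * n.-tuple mR) : n.+1.-tuple mR :=
  [tuple of p.1 :: p.2].

Definition tuple_uncons n (t : n.+1.-tuple mR) : mR * n.-tuple mR :=
  (tnth t ord0, [tuple of behead t]).

Lemma tuple_consK n : cancel (@tuple_cons n) (@tuple_uncons n).
Proof. by case=> x t; congr pair; apply/val_inj. Qed.

Lemma measurable_tuple_cons n : measurable_fun setT (@tuple_cons n).
Proof. exact: measurable_cons. Qed.

Lemma measurable_tuple_uncons n : measurable_fun setT (@tuple_uncons n).
Proof.
apply/measurable_fun_pairP; split; first exact: measurable_tnth.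
exact: measurable_behead.
Qed.

(* Lebesgue measure on R^n, as the n-fold product of [lebesgue_measure]. *)
Fixpoint lebesgue_tuple n :
    {sigma_finite_measure set (n.-tuple mR) -> \bar R} :=
  match n with
  | 0%N => [the {sigma_finite_measure set _ -> \bar R} of \d_[tuple]]
  | n'.+1 => [the {sigma_finite_measure set _ -> \bar R} of
      prod_image (@lebesgue_measure R) (lebesgue_tuple n')
        (@measurable_tuple_cons n') (@measurable_tuple_uncons n')
        (@tuple_consK n')]
  end.

End lebesgue_tuple.

Section channels.
Context {R : realType}.
Local Notation C := R[i].
Local Notation mR := (measurableTypeR R).

(* The identification C^(1 x M) = R^(2M): real parts, then imaginary parts. *)
Definition real_coords {M} (x : 'rV[C]_M) : (M + M).-tuple mR :=
  [tuple match fintype.split k with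
         | inl m => complex.Re (x 0 m)
         | inr m => complex.Im (x 0 m)
         end | k < (M + M)%N].

(* Singular values of F with multiplicity, in nonincreasing order, zeros
   included: square roots of the eigenvalues of the Gram matrix F F^H. *)
Definition singular_values m n (F : 'M[C]_(m, n)) : seq R :=
  sort >=%R [seq Num.sqrt (complex.Re (spectral_diag (F *m F^t*) 0 r))
            | r <- enum 'I_m].

Section random.
Context d (T : measurableType d) (P : probability T R).

Definition has_density M (X : T -> 'rV[C]_M) (f : (M + M).-tuple mR -> R) :=
  [/\ measurable_fun setT (real_coords \o X),
      measurable_fun setT f,
      (forall t, 0 <= f t) &
      forall B, measurable B ->
        P ((real_coords \o X) @^-1` B)
        = (\int[lebesgue_tuple (M + M)]_(t in B) (f t)%:E)%E].

Definition mutually_independent (K : finType) M (X : K -> T -> 'rV[C]_M) :=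
  forall B : K -> set ((M + M).-tuple mR), (forall k, measurable (B k)) ->
    P (\bigcap_(k in [set: K]) ((real_coords \o X k) @^-1` B k))
    = (\prod_(k : K) P ((real_coords \o X k) @^-1` B k))%E.

Definition channel_assumption M KI KE
    (h : 'I_KI -> T -> 'rV[C]_M) (g : 'I_KE -> T -> 'rV[C]_M)
    (fh : 'I_KI -> (M + M).-tuple mR -> R)
    (fg : 'I_KE -> (M + M).-tuple mR -> R) :=
  let X (k : 'I_KI + 'I_KE) :=
    match k with inl i => h i | inr j => g j end in
  [/\ mutually_independent X,
      (forall i, has_density (h i) (fh i)),
      (forall j, has_density (g j) (fg j)) &
      forall n (s : 'I_n -> 'I_KI + 'I_KE),
        (0 < n <= M)%N -> injective s ->
        {ae P, forall w,
          let F : 'M[C]_(n, M) := \matrix_(r < n) X (s r) w in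
          let tau := [seq t <- singular_values F | t != 0] in
          \rank F = n /\
          [/\ size tau = n, sorted >%R tau & all (> 0) tau]}].

End random.
End channels.

Section beamforming.
Context {R : realType}.
Local Notation C := R[i].

Definition sqnorm M (v : 'cV[C]_M) : C := \sum_m `|v m 0| ^+ 2.

Definition psdmx M (A : 'M[C]_M) :=
  A \is hermsymmx /\ forall x : 'cV[C]_M, 0 <= (x^t* *m A *m x) 0 0.

(* The order on C is partial ([a <= b] iff [b - a] is a nonnegative real), so
   this forces every eigenvalue of A to have the imaginary part of [xi]; for
   Hermitian A all of them are real.  [eigenvalue] is defined with row
   eigenvectors, which gives the same spectrum as column eigenvectors. *)
Definition largest_eigenvalue M (A : 'M[C]_M) (xi : C) :=
  eigenvalue A xi /\ forall a, eigenvalue A a -> a <= xi.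

Definition dominant_unit_eigenvector M (A : 'M[C]_M) (v : 'cV[C]_M) :=
  exists xi, [/\ largest_eigenvalue A xi, A *m v = xi *: v & sqnorm v = 1].

Definition energy_matrix M KE (zeta : R) (alpha : 'I_KE -> R)
    (g : 'I_KE -> 'rV[C]_M) : 'M[C]_M :=
  zeta%:C *: \sum_j (alpha j)%:C *: ((g j)^t* *m g j).

Definition gain M (h : 'rV[C]_M) (w : 'cV[C]_M) : C := `|(h *m w) 0 0| ^+ 2.

Section users.
Context (M KI : nat) (h : 'I_KI -> 'rV[C]_M) (sigma2 gamma : 'I_KI -> R)
  (Pmax : R).

Definition sinr_feasible :=
  exists w : 'I_KI -> 'cV[C]_M,
    (forall i, (gamma i)%:C <=
       gain (h i) (w i) /
       (\sum_(k | k != i) gain (h i) (w k) + (sigma2 i)%:C)) /\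
    \sum_i sqnorm (w i) <= Pmax%:C.

Definition aligned_feasible (v : 'cV[C]_M) :=
  exists p : 'I_KI -> R,
    [/\ (forall i, 0 <= p i),
        \sum_i p i <= Pmax &
        forall i, (gamma i)%:C <=
          (p i)%:C * gain (h i) v /
          (\sum_(k | k != i) (p k)%:C * gain (h i) v + (sigma2 i)%:C)].

Definition sdr2_feasible (W : 'I_KI -> 'M[C]_M) (WE : 'M[C]_M) :=
  [/\ (forall i, 0 <= \tr ((h i)^t* *m h i *m W i) / (gamma i)%:C
          - \sum_(k | k != i) \tr ((h i)^t* *m h i *m W k) - (sigma2 i)%:C),
      \sum_i \tr (W i) + \tr WE <= Pmax%:C,
      (forall i, psdmx (W i)) &
      psdmx WE].

Definition sdr2_objective (G : 'M[C]_M) (W : 'I_KI -> 'M[C]_M)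
    (WE : 'M[C]_M) : C :=
  \sum_i \tr (G *m W i) + \tr (G *m WE).

Definition sdr2_optimal (G : 'M[C]_M) (W : 'I_KI -> 'M[C]_M)
    (WE : 'M[C]_M) :=
  sdr2_feasible W WE /\
  forall W' WE', sdr2_feasible W' WE' ->
    sdr2_objective G W' WE' <= sdr2_objective G W WE.

End users.
End beamforming.

(* Main.v *)
(* Deterministic part.  Fritz John multipliers (mu, lam, beta) >= 0, not all zero,
   exist for the program without any Slater condition, and the Lagrangian they
   define is maximal, with value 0, at the optimum.  Perturbing the optimum along
   rank-one directions x x^H shows that the quadratic form
     b_i(x) = mu x^H G x + (lam_i / gamma_i) |h_i x|^2
              - sum_(k != i) lam_k |h_k x|^2 - beta |x|^2
   is nonpositive, and zero on the eigenvectors of W_i with nonzero eigenvalue.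
   When the part of b_i other than the h_i term is negative definite, W_i has rank
   at most one.  This holds if beta > mu xi_E, and then W_E = 0.  If
   beta = mu xi_E, simplicity of xi_E makes W_E a multiple of v_E v_E^H; either
   some lam_k with k != i is positive, and h_k v_E != 0 gives definiteness, or
   all lam vanish and every W_i is a multiple of v_E v_E^H, contradicting the
   infeasibility of alignment.

   Probabilistic part.  Only two almost sure facts are used: g_j0 is not
   orthogonal to the top eigenspace of the energy matrix deprived of its j0-th
   term (whence xi_E is simple), and h_i is not orthogonal to that of G.  Both
   assert that a channel with a density avoids a hyperplane determined by an
   independent matrix, so they follow from Fubini's theorem.  The condition on
   singular values does not give them, because the weights alpha_j differ. *)
Require Import Defs.
From HB Require Import structures.
From mathcomp Require Import all_boot all_order all_algebra.
From mathcomp Require Import complex ring lra.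
From mathcomp Require Import all_classical all_reals all_analysis.
From mathcomp Require Import measurable_realfun.

Set Implicit Arguments.
Unset Strict Implicit.
Unset Printing Implicit Defensive.

Import Order.TTheory GRing.Theory Num.Theory.
Import numFieldNormedType.Exports.

Local Open Scope classical_set_scope.
Local Open Scope ring_scope.
Local Open Scope complex_scope.
Local Open Scope sesquilinear_scope.

(** * Quadratic forms and spectral resolutions *)

Section complex_parts.
Context {R : realType}.
Implicit Types z w : R[i].

(** Taking values in [R] rather than in [R[i]] keeps all later inequalities in a totally ordered
    field. *)
Definition sqmod z : R := complex.Re z ^+ 2 + complex.Im z ^+ 2.

Lemma sqmodE z : (sqmod z)%:C = `|z| ^+ 2.
Proof. exact: add_Re2_Im2. Qed.

Lemma sqmod_mulC z : (sqmod z)%:C = z * z^*%R.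
Proof. by rewrite sqmodE normCK. Qed.

Lemma sqmod_ge0 z : 0 <= sqmod z.
Proof. by rewrite addr_ge0// sqr_ge0. Qed.

Lemma sqmod_eq0 z : (sqmod z == 0) = (z == 0).
Proof. by rewrite -(inj_eq (@complexI R)) sqmodE expf_eq0/= normr_eq0. Qed.

Lemma sqmod0 : sqmod 0 = 0.
Proof. by apply/eqP; rewrite sqmod_eq0. Qed.

Lemma sqmod_gt0 z : (0 < sqmod z) = (z != 0).
Proof. by rewrite lt_neqAle sqmod_ge0 andbT eq_sym sqmod_eq0. Qed.

Lemma sqmodM z w : sqmod (z * w) = sqmod z * sqmod w.
Proof. by apply: complexI; rewrite rmorphM/= !sqmodE normrM exprMn. Qed.

Lemma sqmod_parallelogram z w :
  sqmod (z + w) + sqmod (z - w) = 2 * sqmod z + 2 * sqmod w.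
Proof. by case: z w => [a b] [c e]; rewrite /sqmod /=; ring. Qed.

Lemma ReD z w : complex.Re (z + w) = complex.Re z + complex.Re w.
Proof. by case: z w => [? ?] [? ?]. Qed.

Lemma Re_sum (I : finType) (Q : pred I) (F : I -> R[i]) :
  complex.Re (\sum_(i | Q i) F i) = \sum_(i | Q i) complex.Re (F i).
Proof. by elim/big_rec2 : _ => // i x y _ <-; rewrite ReD. Qed.

Lemma Re_realM (a : R) z : complex.Re (a%:C * z) = a * complex.Re z.
Proof. by case: z => x y /=; rewrite mul0r subr0. Qed.

Lemma ge0_RRe z : 0 <= z -> z = (complex.Re z)%:C.
Proof. by move=> z0; rewrite RRe_real// ger0_real. Qed.

End complex_parts.

Section quadratic_forms.
Context {R : realType} {M : nat}.
Local Notation C := R[i].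
Implicit Types (x y u v : 'cV[C]_M) (A W : 'M[C]_M) (h : 'rV[C]_M).

Definition ev h x : C := (h *m x) 0 0.

Lemma evD h x y : ev h (x + y) = ev h x + ev h y.
Proof. by rewrite /ev mulmxDr mxE. Qed.

Lemma evB h x y : ev h (x - y) = ev h x - ev h y.
Proof. by rewrite /ev mulmxBr 3!mxE. Qed.

Lemma evZ h c x : ev h (c *: x) = c * ev h x.
Proof. by rewrite /ev -scalemxAr mxE. Qed.

Definition norm2 x : R := \sum_m sqmod (x m 0).

Lemma sqnormE x : sqnorm x = (norm2 x)%:C.
Proof.
by rewrite /norm2 raddf_sum; apply: eq_bigr => m _; rewrite /= sqmodE.
Qed.

Lemma norm2_ge0 x : 0 <= norm2 x.
Proof. by apply: sumr_ge0 => m _; exact: sqmod_ge0. Qed.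

Lemma norm2_gt0 x : x != 0 -> 0 < norm2 x.
Proof.
move=> x0; rewrite lt_neqAle norm2_ge0 andbT eq_sym.
apply: contra x0; rewrite psumr_eq0 => [/allP xm|m _]; last exact: sqmod_ge0.
apply/eqP/matrixP => i j; rewrite ord1 mxE; apply/eqP.
by rewrite -sqmod_eq0; apply: xm; rewrite mem_index_enum.
Qed.

Lemma adjmx_mul m n p (A : 'M[C]_(m, n)) (B : 'M[C]_(n, p)) :
  (A *m B)^t* = B^t* *m A^t*.
Proof. by rewrite trmx_mul map_mxM. Qed.

Lemma adjmxZ m n c (A : 'M[C]_(m, n)) : (c *: A)^t* = c^*%R *: A^t*.
Proof. by apply/matrixP => i j; rewrite !mxE rmorphM. Qed.

Lemma adj_mul_self x : (x^t* *m x) 0 0 = (norm2 x)%:C.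
Proof.
rewrite mxE /norm2 raddf_sum; apply: eq_bigr => m _.
by rewrite /= !mxE sqmod_mulC mulrC.
Qed.

Lemma mul_adj_col h x : (x^t* *m h^t*) 0 0 = (ev h x)^*%R.
Proof. by rewrite -adjmx_mul 2!mxE. Qed.

Definition qf A x : R := complex.Re ((x^t* *m A *m x) 0 0).

Lemma qf_scalar x : qf 1%:M x = norm2 x.
Proof. by rewrite /qf mulmx1 adj_mul_self. Qed.

Lemma qf_gram h x : qf (h^t* *m h) x = sqmod (ev h x).
Proof.
rewrite /qf mulmxA -mulmxA mxE big_ord1 mul_adj_col -/(ev _ _) mulrC.
by rewrite -sqmod_mulC.
Qed.

(** The parallelogram law together with homogeneity under complex scalars stands in for an explicit
    polar form. *)
Definition quadratic (b : 'cV[C]_M -> R) :=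
  (forall x y, b (x + y) + b (x - y) = 2 * b x + 2 * b y) /\
  (forall c x, b (c *: x) = sqmod c * b x).

Lemma quadratic_ev h : quadratic (fun x => sqmod (ev h x)).
Proof.
split=> [x y|c x]; first by rewrite evD evB sqmod_parallelogram.
by rewrite evZ sqmodM.
Qed.

Lemma quadratic_sum (I : finType) (Q : pred I) b :
  (forall i, quadratic (b i)) -> quadratic (fun x => \sum_(i | Q i) b i x).
Proof.
move=> qb; split=> [x y|c x].
  rewrite !mulr_sumr -!big_split/=.
  by apply: eq_bigr => i _; rewrite (proj1 (qb i)).
by rewrite mulr_sumr; apply: eq_bigr => i _; rewrite (proj2 (qb i)).
Qed.

Lemma quadraticD b b' : quadratic b -> quadratic b' ->
  quadratic (fun x => b x + b' x).
Proof.
move=> [b1 b2] [b1' b2']; split=> [x y|c x]; last by rewrite b2 b2'; ring.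
by rewrite addrACA b1 b1'; ring.
Qed.

Lemma quadraticZ k b : quadratic b -> quadratic (fun x => k * b x).
Proof.
move=> [b1 b2]; split=> [x y|c x]; last by rewrite b2; ring.
by rewrite -mulrDr b1; ring.
Qed.

Lemma quadratic_norm2 : quadratic norm2.
Proof.
apply: (@quadratic_sum _ _ (fun m x => sqmod (x m 0))) => m.
split=> [x y|c x]; last by rewrite mxE sqmodM.
by rewrite !mxE sqmod_parallelogram.
Qed.

Lemma quadratic_qf A : quadratic (qf A).
Proof.
split=> [x y|c x].
  have adjD (w z : 'cV[C]_M) : (w + z)^t* = w^t* + z^t*.
    by apply/matrixP => i j; rewrite !mxE rmorphD.
  have adjN : (- y)^t* = - y^t*.
    by apply/matrixP => i j; rewrite !mxE rmorphN.
  (* Only the additivity of [F] in each argument is kept; the cross terms coming from [x + y] and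
     [x - y] then cancel. *)
  pose F (a b : 'cV[C]_M) : C := (a^t* *m A *m b) 0 0.
  have FDl a b c : F (a + b) c = F a c + F b c.
    by rewrite /F adjD !mulmxDl mxE.
  have FDr a b c : F a (b + c) = F a b + F a c by rewrite /F mulmxDr mxE.
  have FNl b : F (- y) b = - F y b by rewrite /F adjN !mulNmx mxE.
  have FNr a : F a (- y) = - F a y by rewrite /F mulmxN mxE.
  have qfF z : qf A z = complex.Re (F z z) by [].
  clearbody F; rewrite !qfF !FDl !FDr !FNl !FNr opprK !ReD.
  have ReN (z : C) : complex.Re (- z) = - complex.Re z by case: z.
  move: (F x x) (F x y) (F y x) (F y y) => a b c d.
  by rewrite !ReN; ring.
rewrite /qf adjmxZ -scalemxAr -!scalemxAl scalerA mxE -sqmod_mulC.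
by rewrite Re_realM.
Qed.

(** By the parallelogram law the values at [c *: x + e *: y] and [c *: x - e *: y] add up to 0; both
    being nonpositive, both vanish. *)
Lemma quadratic_nonpos_null b x y : quadratic b -> (forall z, b z <= 0) ->
  b x = 0 -> b y = 0 -> forall c e, b (c *: x + e *: y) = 0.
Proof.
move=> [b1 b2] bn bx by0 c e; have := b1 (c *: x) (e *: y).
rewrite !b2 bx by0 !mulr0 addr0.
have := bn (c *: x + e *: y); have := bn (c *: x - e *: y); lra.
Qed.

End quadratic_forms.

Section spectral.
Context {R : realType} {M : nat}.
Local Notation C := R[i].
Implicit Types (x y v : 'cV[C]_M) (A W : 'M[C]_M) (h : 'rV[C]_M).

(** Eigenvalues are listed with multiplicity, in no particular order, and the [u r] form an
    orthonormal basis. Since [e] is nonnegative, only positive semidefinite matrices have such a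
    resolution. *)
Definition spectral_resolution A (e : 'I_M -> R) (u : 'I_M -> 'cV[C]_M) :=
  [/\ forall r, 0 <= e r,
      forall r s, (u r)^t* *m u s = (r == s)%:R%:M,
      1%:M = \sum_r u r *m (u r)^t* &
      A = \sum_r (e r)%:C *: (u r *m (u r)^t*)].

(** Unitary diagonalisation of a normal matrix; the eigenvalues are nonnegative because they are the
    values of the form at the unit eigenvectors. *)
Lemma psd_spectral_resolution A : psdmx A ->
  exists e u, spectral_resolution A e u.
Proof.
move=> [Ah Apos].
have AE := orthomx_spectralP (hermitian_normalmx Ah).
have Dreal := hermitian_spectral_diag_real Ah.
have Pu := spectral_unitarymx A.
set P := spectralmx A in AE Pu; set D := spectral_diag A in AE Dreal.
have PPt : P *m P^t* = 1%:M by apply/unitarymxP.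
have PtP : P^t* *m P = 1%:M by apply: mulmx1C.
rewrite invmx_unitary// in AE.
pose u r := col r (P^t*).
have ut r : (u r)^t* = row r P.
  by apply/matrixP => i j; rewrite !mxE conjCK.
have uo r s : (u r)^t* *m u s = (r == s)%:R%:M.
  rewrite ut; apply/matrixP => i j; rewrite !ord1.
  have /matrixP/(_ r s) := PPt; rewrite !mxE eqxx mulr1n => <-.
  by apply: eq_bigr => k _; rewrite !mxE.
have AsumC : A = \sum_r D 0 r *: (u r *m (u r)^t*).
  rewrite {1}AE; apply/matrixP => i j; rewrite summxE mxE.
  apply: eq_bigr => r _; rewrite ut mul_mx_diag !mxE big_ord1 !mxE.
  by rewrite mulrCA mulrA.
have Au r : ((u r)^t* *m A *m u r) 0 0 = D 0 r.
  rewrite AsumC mulmx_sumr mulmx_suml summxE (bigD1 r)//= big1 ?addr0.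
    rewrite -scalemxAr -scalemxAl mulmxA uo eqxx mul1mx uo eqxx mxE.
    by rewrite !mxE mulr1.
  move=> s sr; rewrite -scalemxAr -scalemxAl mulmxA uo eq_sym (negbTE sr).
  by rewrite mul_scalar_mx scale0r mul0mx scaler0 mxE.
have De r : D 0 r = (complex.Re (D 0 r))%:C.
  by apply: ge0_RRe; rewrite -Au; exact: Apos.
exists (fun r => complex.Re (D 0 r)), u; split=> //.
- by move=> r; rewrite -lecR -De -Au; exact: Apos.
- rewrite -PtP; apply/matrixP => i j; rewrite summxE mxE.
  by apply: eq_bigr => r _; rewrite ut !mxE big_ord1 !mxE.
- by rewrite {1}AsumC; apply: eq_bigr => r _; rewrite {1}De.
Qed.

Section resolution.
Context {A : 'M[C]_M} {e : 'I_M -> R} {u : 'I_M -> 'cV[C]_M}.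
Hypothesis Aeu : spectral_resolution A e u.

Lemma resolution_gt0 r : e r != 0 -> 0 < e r.
Proof. by rewrite lt_neqAle eq_sym => ->; have [e0 _ _ _] := Aeu; exact: e0. Qed.

Lemma resolution_norm2 r : norm2 (u r) = 1.
Proof.
case: Aeu => _ uo _ _; apply: complexI.
by rewrite -adj_mul_self uo eqxx mxE.
Qed.

Lemma resolution_neq0 r : u r != 0.
Proof.
apply/eqP => ur0; have := resolution_norm2 r; rewrite ur0 /norm2 big1.
  by move/esym/eqP; rewrite oner_eq0.
by move=> m _; apply/eqP; rewrite sqmod_eq0 mxE.
Qed.

Lemma resolution_eigen r : A *m u r = (e r)%:C *: u r.
Proof.
case: Aeu => _ uo _ AE; rewrite [in LHS]AE mulmx_suml (bigD1 r)//= big1 ?addr0.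
  by rewrite -scalemxAl -mulmxA uo eqxx mulmx1.
move=> s sr; rewrite -scalemxAl -mulmxA uo (negbTE sr).
by rewrite mul_mx_scalar scale0r scaler0.
Qed.

Lemma resolution_exp n :
  A ^+ n = \sum_r ((e r) ^+ n)%:C *: (u r *m (u r)^t*).
Proof.
case: Aeu => _ _ oneE _; elim: n => [|n IHn].
  by rewrite expr0 [LHS]oneE; apply: eq_bigr => r _; rewrite expr0 scale1r.
rewrite exprS IHn mulr_sumr; apply: eq_bigr => r _.
rewrite -[_ * _]/(_ *m _) -scalemxAr mulmxA resolution_eigen -scalemxAl scalerA.
by rewrite -rmorphM/= exprSr.
Qed.

Lemma resolution_tr n : \tr (A ^+ n) = (\sum_r (e r) ^+ n)%:C.
Proof.
rewrite resolution_exp raddf_sum raddf_sum; apply: eq_bigr => r _ /=.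
case: Aeu => _ uo _ _.
by rewrite linearZ/= mxtrace_mulC uo eqxx mxtrace1 mulr1.
Qed.

Lemma row_outer_adj h v : (h *m (v *m v^t*) *m h^t*) 0 0 = (sqmod (ev h v))%:C.
Proof.
by rewrite mulmxA -mulmxA mxE big_ord1 mul_adj_col sqmod_mulC.
Qed.

(** The exponents 0 and 1 yield the norm and the quadratic form; general exponents serve the growth
    comparison in [decaying]. *)
Lemma resolution_row n h :
  (h *m A ^+ n *m h^t*) 0 0 = (\sum_r (e r) ^+ n * sqmod (ev h (u r)))%:C.
Proof.
rewrite resolution_exp mulmx_sumr mulmx_suml summxE raddf_sum.
apply: eq_bigr => r _; rewrite -scalemxAr -scalemxAl mxE row_outer_adj.
by rewrite /= rmorphM.
Qed.

Lemma resolution_qf x : qf A x = \sum_r e r * sqmod (ev (x^t*) (u r)).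
Proof.
rewrite /qf -[A]expr1 -{2}[x]trmxCK resolution_row /=.
by apply: eq_bigr => r _; rewrite expr1.
Qed.

Lemma resolution_sum_norm2 x : norm2 x = \sum_r sqmod (ev (x^t*) (u r)).
Proof.
rewrite -qf_scalar /qf -[1%:M](expr0 A) -{2}[x]trmxCK resolution_row /=.
by apply: eq_bigr => r _; rewrite expr0 mul1r.
Qed.

Lemma resolution_trW :  \tr A = (\sum_r e r)%:C.
Proof.
have := resolution_tr 1; rewrite expr1 => ->.
by rewrite -(eq_bigr _ (fun _ _ => expr1 _)).
Qed.

Lemma resolution_aligned v : (forall r, e r != 0 -> exists c, u r = c *: v) ->
  exists2 q, 0 <= q & A = q%:C *: (v *m v^t*).
Proof.
move=> uv; case: (Aeu) => e0 _ _ AE.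
have {uv} [c cE] : exists c : 'I_M -> C, forall r, e r != 0 -> u r = c r *: v.
  have H r : exists cr, e r != 0 -> u r = cr *: v.
    (* Eigenvectors of eigenvalue 0 receive the default coefficient 0; their terms vanish in any
       case. *)
    by have [er|/uv[cr ->]] := eqVneq (e r) 0; [exists 0|exists cr].
  by have [c cE] := choice H; exists c.
exists (\sum_r e r * sqmod (c r)).
  by apply: sumr_ge0 => r _; rewrite mulr_ge0 ?sqmod_ge0.
rewrite AE raddf_sum scaler_suml; apply: eq_bigr => r _ /=.
have [->|/cE ->] := eqVneq (e r) 0; first by rewrite mul0r !scale0r.
rewrite adjmxZ -scalemxAr -scalemxAl !scalerA rmorphM/= sqmod_mulC.
by congr (_ *: _); ring.
Qed.

End resolution.

Lemma hermsymmxP A : reflect (A^t* = A) (A \is hermsymmx).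
Proof. by rewrite is_hermitianmxE expr0 scale1r eq_sym; exact: eqP. Qed.

Lemma psd_outer k v : 0 <= k -> psdmx (k%:C *: (v *m v^t*)).
Proof.
move=> k0; split.
  apply/hermsymmxP; rewrite adjmxZ adjmx_mul trmxCK.
  by rewrite conj_Creal// complex_real.
move=> x; rewrite -scalemxAr -scalemxAl mxE -{2}[x]trmxCK row_outer_adj.
by rewrite -rmorphM/= lecR mulr_ge0 ?sqmod_ge0.
Qed.

Lemma psdD A W : psdmx A -> psdmx W -> psdmx (A + W).
Proof.
move=> [/hermsymmxP Ah Ap] [/hermsymmxP Wh Wp]; split.
  apply/hermsymmxP/matrixP => i j; rewrite !mxE rmorphD/=.
  by rewrite -[in RHS]Ah -[in RHS]Wh !mxE.
by move=> x; rewrite mulmxDr mulmxDl mxE addr_ge0.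
Qed.

Lemma psd_scale k A : 0 <= k -> psdmx A -> psdmx (k%:C *: A).
Proof.
move=> k0 [/hermsymmxP Ah Ap]; split.
  by apply/hermsymmxP; rewrite adjmxZ Ah conj_Creal// complex_real.
by move=> x; rewrite -scalemxAr -scalemxAl mxE mulr_ge0// lecR.
Qed.

Lemma psd0 : psdmx (0 : 'M[C]_M).
Proof.
split; first by apply/hermsymmxP/matrixP => i j; rewrite !mxE rmorph0.
by move=> x; rewrite mulmx0 mul0mx mxE.
Qed.

Lemma psd_sum (I : finType) (Q : pred I) (F : I -> 'M[C]_M) :
  (forall i, Q i -> psdmx (F i)) -> psdmx (\sum_(i | Q i) F i).
Proof.
move=> F0; elim/big_rec: _ => [|i A Qi Ap]; first exact: psd0.
exact: psdD (F0 _ Qi) Ap.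
Qed.

(** What remains is the sum of the other spectral terms. This is what allows a perturbation in the
    negative direction along an eigenvector. *)
Lemma psd_resolutionB A e u r : spectral_resolution A e u ->
  psdmx (A - (e r)%:C *: (u r *m (u r)^t*)).
Proof.
case=> e0 _ _ AE.
rewrite [in X in psdmx (X - _)]AE (bigD1 r)//= [X in X - _]addrC addrK.
by apply: psd_sum => s _; exact: psd_outer.
Qed.

Lemma psd_tr_ge0 A : psdmx A -> 0 <= \tr A.
Proof.
move=> /psd_spectral_resolution[e [u Aeu]].
by rewrite (resolution_trW Aeu) lecR; apply: sumr_ge0 => r _; case: Aeu.
Qed.

Lemma tr_outer_psd h A : \tr (h^t* *m h *m A) = (h *m A *m h^t*) 0 0.
Proof. by rewrite -mulmxA mxtrace_mulC /mxtrace big_ord1. Qed.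

End spectral.

(** * Multipliers *)

Section multipliers.
Context {R : realType} {V : Type} (mix : R -> V -> V -> V).

(** Convex combinations are given by the abstract operation [mix], since the points of the
    application are families of complex matrices combined with real weights. *)
Definition affine (f : V -> R) :=
  forall t x y, f (mix t x y) = (1 - t) * f x + t * f y.

Definition mix_closed (D : set V) :=
  forall t x y, 0 <= t -> t <= 1 -> D x -> D y -> D (mix t x y).

(** Otherwise [g] is positive at the point of the segment from [x] to [y] where [f] vanishes; moving
    slightly back towards [x] makes [f] positive as well and keeps [g] positive. *)
Lemma mix_max_neg (D : set V) f g x y : mix_closed D -> affine f -> affine g ->
  (forall z, D z -> ~ (0 < f z /\ 0 < g z)) ->
  D x -> D y -> 0 < f x -> f y <= 0 -> f x * g y <= f y * g x.
Proof.
move=> Dc fa ga fg Dx Dy fx fy; rewrite leNgt; apply/negP => lt_fg.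
have den : 0 < f x - f y by lra.
(* The parameter at which [f] vanishes on the segment. *)
pose s := f x / (f x - f y).
have s01 : 0 <= s /\ s <= 1.
  split; first by apply: divr_ge0; lra.
  by rewrite ler_pdivrMr//; lra.
have sE : s * (f x - f y) = f x by rewrite /s divfK// gt_eqF.
have gz : 0 < (1 - s) * g x + s * g y.
  have : 0 < ((1 - s) * g x + s * g y) * (f x - f y).
    have -> : ((1 - s) * g x + s * g y) * (f x - f y) =
      (f x - f y) * g x + (s * (f x - f y)) * (g y - g x) by ring.
    by rewrite sE; lra.
  by rewrite pmulr_lgt0.
set c := (1 - s) * g x + s * g y in gz.
have gx : g x <= 0.
  by rewrite leNgt; apply/negP => gx; apply: (fg x Dx).
(* With this [t], moving towards [x] brings [g] down from [c] to exactly [c / 2]. *)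
pose t := c / (2 * (c - g x)).
have den2 : 0 < 2 * (c - g x) by lra.
have t0 : 0 < t by apply: divr_gt0.
have tE : t * (2 * (c - g x)) = c by rewrite /t divfK// gt_eqF.
have t1 : t <= 1 by rewrite ler_pdivrMr//; lra.
apply: (fg (mix t (mix s x y) x)).
  by apply: (Dc) => //; [lra|apply: (Dc) => //; case: s01].
rewrite !fa !ga -/c; split; last by nra.
have -> : (1 - s) * f x + s * f y = f x - s * (f x - f y) by ring.
by rewrite sE subrr mulr0 add0r mulr_gt0.
Qed.

(* If [f] and [g] are never positive together, the slopes [g y / - f y] over
   [f y < 0] lie below all the slopes [- g x / f x] over [0 < f x]; any number in
   between serves as the multiplier of [f]. *)
Lemma two_multipliers (D : set V) f g : mix_closed D -> affine f -> affine g ->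
  (forall z, D z -> ~ (0 < f z /\ 0 < g z)) ->
  exists a b : R, [/\ 0 <= a, 0 <= b, a != 0 \/ b != 0 &
    forall z, D z -> a * f z + b * g z <= 0].
Proof.
move=> Dc fa ga fg.
have [[x Dx fx]|nof] := pselect (exists2 x, D x & 0 < f x); last first.
  exists 1, 0; split=> //; first by left; rewrite oner_eq0.
  move=> z Dz; rewrite mul1r mul0r addr0 leNgt; apply/negP => fz.
  by apply: nof; exists z.
have key := mix_max_neg Dc fa ga fg Dx.
have gx : g x <= 0 by rewrite leNgt; apply/negP => gx; apply: (fg x Dx).
(* The element 0 keeps [S] nonempty when [f] is never negative, and makes its supremum
   nonnegative. *)
pose S : set R := [set s | s = 0 \/
  exists y, [/\ D y, f y < 0 & s = g y / - f y]].
have S0 : S 0 by left.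
have ubS x' : D x' -> 0 < f x' -> ubound S (- g x' / f x').
  move=> Dx' fx' s [->|[y [Dy fy ->]]].
    apply: divr_ge0; last exact: ltW.
    by rewrite oppr_ge0 leNgt; apply/negP => gx'; apply: (fg x' Dx').
  rewrite ler_pdivrMr ?oppr_gt0// mulrAC ler_pdivlMr//.
  have := mix_max_neg Dc fa ga fg Dx' Dy fx' (ltW fy).
  by rewrite mulrNN mulrC [g x' * _]mulrC.
have hsS : has_sup S by split; [exists 0|exists (- g x / f x); exact: ubS].
have t0 : 0 <= sup S by apply: ub_le_sup => //; case: hsS.
exists (sup S), 1; split=> //; first by right; rewrite oner_eq0.
move=> z Dz; rewrite mul1r.
have [fz|fz|fz] := ltgtP (f z) 0.
- have : g z / - f z <= sup S.
    by apply: ub_le_sup; [case: hsS|right; exists z].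
  by rewrite ler_pdivrMr ?oppr_gt0//; lra.
- have : sup S <= - g z / f z by apply: ge_sup; [exists 0|exact: ubS].
  by rewrite ler_pdivlMr//; lra.
- have := key z Dz fx; rewrite fz => /(_ (lexx _)).
  by rewrite mul0r pmulr_rle0// mulr0 add0r.
Qed.

Lemma affine_sum n (f : 'I_n -> V -> R) (l : 'I_n -> R) :
  (forall i, affine (f i)) -> affine (fun x => \sum_i l i * f i x).
Proof.
move=> fa t x y; rewrite !mulr_sumr -big_split/=; apply: eq_bigr => i _.
by rewrite fa; ring.
Qed.

(* Induction on the number of functions: on the part of [D] where the first one
   is positive the others have multipliers, so the first function and that
   combination of the others are never positive together on [D]. *)
Lemma fritz_john n (D : set V) (f : 'I_n.+1 -> V -> R) :
  mix_closed D -> (forall i, affine (f i)) ->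
  (forall z, D z -> ~ (forall i, 0 < f i z)) ->
  exists l : 'I_n.+1 -> R, [/\ forall i, 0 <= l i, exists i, l i != 0 &
    forall z, D z -> \sum_i l i * f i z <= 0].
Proof.
elim: n D f => [|n IHn] D f Dc fa fneg.
  exists (fun=> 1); split=> //; first by exists ord0; rewrite oner_eq0.
  move=> z Dz; rewrite big_ord1 mul1r leNgt; apply/negP => fz.
  by apply: (fneg z Dz) => i; rewrite ord1.
pose D' : set V := [set z | D z /\ 0 < f ord0 z].
have D'c : mix_closed D'.
  move=> t x y t0 t1 [Dx fx] [Dy fy]; split; first exact: (Dc).
  rewrite fa; have [->|t_neq0] := eqVneq t 0; first by rewrite subr0; lra.
  have tp : 0 < t by rewrite lt_neqAle eq_sym t_neq0.
  by rewrite ltr_wpDl ?mulr_gt0// mulr_ge0 ?subr_ge0// ltW.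
have [||l [l0 [i0 li0] lf]] := IHn D' (fun i => f (lift ord0 i)) D'c.
- by move=> i; exact: fa.
- move=> z [Dz fz] fpos; apply: (fneg z Dz) => i.
  by have [j ->|->] := unliftP ord0 i.
have ga := affine_sum l (fun i => fa (lift ord0 i)).
have [|a [b [a0 b0 ab ablf]]] := two_multipliers Dc (fa ord0) ga.
  by move=> z Dz [fz gz]; have := lf z (conj Dz fz); rewrite leNgt gz.
exists (fun i => oapp (fun j => b * l j) a (unlift ord0 i)); split.
- by move=> i; case: unliftP => //= j _; rewrite mulr_ge0.
- case: ab => [a_neq0|b_neq0]; first by exists ord0; rewrite unlift_none.
  by exists (lift ord0 i0); rewrite liftK/= mulf_neq0.
- move=> z Dz; rewrite big_ord_recl unlift_none/=.
  under eq_bigr do rewrite liftK/= -mulrA.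
  by rewrite -mulr_sumr ablf.
Qed.

End multipliers.

(** * Optimality conditions *)

(* As [b <= 0], its isotropic vectors form a subspace; as [n] is negative
   definite, this subspace meets the hyperplane [ev h x = 0] trivially. *)
Lemma isotropic_resolution_rank1 (R : realType) M (A : 'M[R[i]]_M) e u
    (b n : 'cV[R[i]]_M -> R) (c : R) (h : 'rV[R[i]]_M) :
  spectral_resolution A e u -> quadratic b ->
  (forall x, b x = n x + c * sqmod (ev h x)) ->
  (forall x, b x <= 0) -> (forall x, x != 0 -> n x < 0) ->
  (forall r, e r != 0 -> b (u r) = 0) ->
  (\rank A <= 1)%N.
Proof.
move=> Aeu qb bE b0 n0 bu.
have hu r : e r != 0 -> ev h (u r) != 0.
  move=> er; apply/eqP => hur; have := n0 _ (resolution_neq0 Aeu r).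
  have := bE (u r); rewrite bu// hur sqmod0.
  by rewrite mulr0 addr0 => <-; rewrite ltxx.
have uniq r s : e r != 0 -> e s != 0 -> r = s.
  move=> er es; apply/eqP; apply/negP => /negP rs.
  (* A combination of two isotropic vectors that [h] annihilates; it is nonzero because its
     component along [u r] is. *)
  pose x := ev h (u s) *: u r + (- ev h (u r)) *: u s.
  have bx : b x = 0.
    exact: (quadratic_nonpos_null qb b0 (bu _ er) (bu _ es)).
  have hx : ev h x = 0.
    by rewrite /x evD !evZ mulNr mulrC subrr.
  have x0 : x != 0.
    apply/eqP => x0; have := hu s es; apply/negP; rewrite negbK.
    have : ((u r)^t* *m x) 0 0 = 0 by rewrite x0 mulmx0 mxE.
    case: Aeu => _ uo _ _; rewrite /x mulmxDr -!scalemxAr !uo eqxx (negbTE rs).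
    by rewrite !mxE mulr1 mulr0 addr0 => ->.
  have := n0 _ x0; have := bE x; rewrite bx hx sqmod0.
  by rewrite mulr0 addr0 => <-; rewrite ltxx.
have [[r er]|noe] := pselect (exists r, e r != 0).
  have [|q _ ->] := @resolution_aligned _ _ _ _ _ Aeu (u r).
    by move=> s es; exists 1; rewrite scale1r (uniq s r).
  by rewrite scalemxAr (leq_trans (mxrankM_maxl _ _))// rank_leq_col.
(* No eigenvalue is nonzero, so alignment with the zero vector holds vacuously and gives [A = 0]. *)
have [|q _ ->] := @resolution_aligned _ _ _ _ _ Aeu 0.
  by move=> s es; case: noe; exists s.
by rewrite mul0mx scaler0 mxrank0.
Qed.

Section sdr2.
Context {R : realType} {M KI : nat}.
Local Notation C := R[i].
Context (h : 'I_KI -> 'rV[C]_M) (sigma2 gamma : 'I_KI -> R) (Pmax : R)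
  (G : 'M[C]_M).
Implicit Types (W : 'I_KI -> 'M[C]_M) (A B WE : 'M[C]_M) (x : 'cV[C]_M).

Definition rtr (B A : 'M[C]_M) : R := complex.Re (\tr (B *m A)).

Lemma rtrD B A A' : rtr B (A + A') = rtr B A + rtr B A'.
Proof. by rewrite /rtr mulmxDr mxtraceD ReD. Qed.

Lemma rtrZ B k A : rtr B (k%:C *: A) = k * rtr B A.
Proof. by rewrite /rtr -scalemxAr mxtraceZ Re_realM. Qed.

Lemma rtr_outer B x : rtr B (x *m x^t*) = qf B x.
Proof. by rewrite /rtr /qf mulmxA mxtrace_mulC /mxtrace big_ord1 mulmxA. Qed.

Definition hh i : 'M[C]_M := (h i)^t* *m h i.

Lemma qf_hh i x : qf (hh i) x = sqmod (ev (h i) x).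
Proof. exact: qf_gram. Qed.

Lemma tr_hh_psd i A : psdmx A -> \tr (hh i *m A) = (rtr (hh i) A)%:C.
Proof.
move=> [_ Ap]; rewrite /rtr -ge0_RRe// /hh tr_outer_psd -{1}[h i]trmxCK.
exact: Ap.
Qed.

Lemma tr_psd A : psdmx A -> \tr A = (rtr 1%:M A)%:C.
Proof. by move=> Ap; rewrite /rtr mul1mx -ge0_RRe// psd_tr_ge0. Qed.

Lemma rtr_hh_ge0 i A : psdmx A -> 0 <= rtr (hh i) A.
Proof.
move=> Ap; rewrite -lecR -(tr_hh_psd i Ap) /hh tr_outer_psd.
by rewrite -{1}[h i]trmxCK; case: Ap.
Qed.

Lemma rtr1_ge0 A : psdmx A -> 0 <= rtr 1%:M A.
Proof. by move=> Ap; rewrite -lecR -(tr_psd Ap); exact: psd_tr_ge0. Qed.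

Definition sinr_slack W i : R :=
  rtr (hh i) (W i) / gamma i - \sum_(k | k != i) rtr (hh i) (W k) - sigma2 i.

Definition power W WE : R := \sum_i rtr 1%:M (W i) + rtr 1%:M WE.

Definition energy W WE : R := \sum_i rtr G (W i) + rtr G WE.

(** On positive semidefinite matrices all the traces involved are real, so the constraints in the
    partial order of [R[i]] become inequalities in [R]. *)
Lemma sdr2_feasibleP W WE : (forall i, psdmx (W i)) -> psdmx WE ->
  sdr2_feasible h sigma2 gamma Pmax W WE <->
  (forall i, 0 <= sinr_slack W i) /\ power W WE <= Pmax.
Proof.
move=> Wp WEp.
have cE i : \tr (hh i *m W i) / (gamma i)%:C
    - \sum_(k | k != i) \tr (hh i *m W k) - (sigma2 i)%:C
    = (sinr_slack W i)%:C.
  rewrite /sinr_slack !rmorphB/= rmorphM/= fmorphV tr_hh_psd//.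
  congr (_ - _ - _); rewrite rmorph_sum; apply: eq_bigr => k _ /=.
  by rewrite tr_hh_psd.
have pE : \sum_i \tr (W i) + \tr WE = (power W WE)%:C.
  rewrite /power rmorphD/= tr_psd// rmorph_sum; congr (_ + _).
  by apply: eq_bigr => k _; rewrite /= tr_psd.
split=> [[c p _ _]|[c p]].
  by split=> [i|]; [move: (c i); rewrite cE lecR|move: p; rewrite pE lecR].
by split=> // [i|]; [rewrite cE lecR|rewrite pE lecR].
Qed.

Section multipliers.
Variables (mu beta : R) (lam : 'I_KI -> R).

(** The part of the Lagrangian that depends on the [i]-th matrix: its own SINR constraint
    contributes the [lam i / gamma i] term, and its interference with user [k] the [lam k] term. *)
Definition marginal i (A : 'M[C]_M) : R :=
  mu * rtr G A - beta * rtr 1%:M A + lam i / gamma i * rtr (hh i) A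
  - \sum_(k | k != i) lam k * rtr (hh k) A.

Definition marginalE (A : 'M[C]_M) : R := mu * rtr G A - beta * rtr 1%:M A.

(** Regroups the Lagrangian by matrix instead of by constraint, by exchanging the double sum over
    ordered pairs of distinct users. *)
Lemma lagrangianE W WE :
  mu * energy W WE + (beta * (Pmax - power W WE) + \sum_i lam i * sinr_slack W i)
  = \sum_i marginal i (W i) + marginalE WE
    + (beta * Pmax - \sum_i lam i * sigma2 i).
Proof.
have -> : \sum_i lam i * sinr_slack W i =
    \sum_i (lam i / gamma i * rtr (hh i) (W i)
            - \sum_(k | k != i) lam k * rtr (hh k) (W i))
    - \sum_i lam i * sigma2 i.
  have -> : \sum_i (lam i / gamma i * rtr (hh i) (W i)
       - \sum_(k | k != i) lam k * rtr (hh k) (W i)) =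
     \sum_i (lam i / gamma i * rtr (hh i) (W i)
       - \sum_(k | k != i) lam i * rtr (hh i) (W k)).
    rewrite !sumrB; congr (_ - _).
    rewrite (exchange_big_dep predT)//=; apply: eq_bigr => i _.
    by apply: eq_bigl => k; rewrite eq_sym.
  rewrite -sumrB; apply: eq_bigr => i _.
  by rewrite /sinr_slack -mulr_sumr; ring.
rewrite /marginal /marginalE /energy /power !sumrB !big_split/= !sumrN -!mulr_sumr.
by ring.
Qed.

Lemma marginalD i A A' : marginal i (A + A') = marginal i A + marginal i A'.
Proof.
rewrite /marginal !rtrD; under eq_bigr do rewrite rtrD mulrDr.
by rewrite big_split/=; ring.
Qed.

Lemma marginalZ i k A : marginal i (k%:C *: A) = k * marginal i A.
Proof.
rewrite /marginal !rtrZ; under eq_bigr do rewrite rtrZ mulrCA.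
by rewrite -mulr_sumr; ring.
Qed.

Lemma marginalED A A' : marginalE (A + A') = marginalE A + marginalE A'.
Proof. by rewrite /marginalE !rtrD; ring. Qed.

Lemma marginalEZ k A : marginalE (k%:C *: A) = k * marginalE A.
Proof. by rewrite /marginalE !rtrZ; ring. Qed.

Definition interference_form i x : R :=
  mu * qf G x - beta * norm2 x - \sum_(k | k != i) lam k * sqmod (ev (h k) x).

Lemma marginal_outer i x : marginal i (x *m x^t*) =
  interference_form i x + lam i / gamma i * sqmod (ev (h i) x).
Proof.
rewrite /marginal !rtr_outer qf_scalar qf_hh.
under eq_bigr do rewrite rtr_outer qf_hh.
by rewrite /interference_form; ring.
Qed.

Lemma marginalE_outer x : marginalE (x *m x^t*) = mu * qf G x - beta * norm2 x.
Proof. by rewrite /marginalE !rtr_outer qf_scalar. Qed.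

Lemma quadratic_marginal i : quadratic (fun x => marginal i (x *m x^t*)).
Proof.
have -> : (fun x => marginal i (x *m x^t*)) = (fun x =>
    mu * qf G x + (- beta) * norm2 x
    + (-1) * \sum_(k | k != i) lam k * sqmod (ev (h k) x)
    + lam i / gamma i * sqmod (ev (h i) x)).
  by apply/funext => x; rewrite marginal_outer /interference_form; ring.
apply: quadraticD; last exact/quadraticZ/quadratic_ev.
apply: quadraticD.
  by apply: quadraticD; apply: quadraticZ;
    [exact: quadratic_qf|exact: quadratic_norm2].
apply: quadraticZ; apply: quadratic_sum => k.
exact/quadraticZ/quadratic_ev.
Qed.

End multipliers.

Section optimum.
Variables (W : 'I_KI -> 'M[C]_M) (WE : 'M[C]_M).
Hypothesis opt : sdr2_optimal h sigma2 gamma Pmax G W WE.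

(** If the gain in energy and all the slacks were positive at once, some feasible point would beat
    the optimum; hence [fritz_john] applies on the cone of positive semidefinite families. *)
Lemma sdr2_multipliers : exists (mu beta : R) (lam : 'I_KI -> R),
  [/\ 0 <= mu /\ 0 <= beta, forall i, 0 <= lam i,
      [\/ mu != 0, beta != 0 | exists i, lam i != 0] &
      forall W' WE', (forall i, psdmx (W' i)) -> psdmx WE' ->
      mu * (energy W' WE' - energy W WE) +
      (beta * (Pmax - power W' WE') + \sum_i lam i * sinr_slack W' i) <= 0].
Proof.
case: opt => feas best.
pose V := (('I_KI -> 'M[C]_M) * 'M[C]_M)%type.
pose mix (t : R) (x y : V) : V :=
  ((fun i => (1 - t)%:C *: x.1 i + t%:C *: y.1 i),
   (1 - t)%:C *: x.2 + t%:C *: y.2).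
pose D : set V := [set x | (forall i, psdmx (x.1 i)) /\ psdmx x.2].
have Dc : mix_closed mix D.
  move=> t x y t0 t1 [x1 x2] [y1 y2]; have t1' : 0 <= 1 - t by rewrite subr_ge0.
  have mixp A B (Ap : psdmx A) (Bp : psdmx B) :
    psdmx ((1 - t)%:C *: A + t%:C *: B).
    exact: psdD (psd_scale t1' Ap) (psd_scale t0 Bp).
  by split=> [i|]; [exact: mixp (x1 i) (y1 i)|exact: mixp x2 y2].
pose obj (x : V) := energy x.1 x.2 - energy W WE.
pose pow (x : V) := Pmax - power x.1 x.2.
(* Index 0 is the gain in energy, index 1 the power slack, and the remaining ones are the SINR
   slacks. *)
pose f (i : 'I_KI.+2) (x : V) : R :=
  oapp (fun j => oapp (fun k => sinr_slack x.1 k) (pow x) (unlift ord0 j))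
    (obj x) (unlift ord0 i).
have sum_mix B t (x y : V) : \sum_i rtr B ((mix t x y).1 i) =
    (1 - t) * \sum_i rtr B (x.1 i) + t * \sum_i rtr B (y.1 i).
  rewrite !mulr_sumr -big_split/=; apply: eq_bigr => i _.
  by rewrite rtrD !rtrZ.
have fa i : affine mix (f i).
  move=> t x y; rewrite /f; case: unliftP => [j _|_] /=.
    case: unliftP => [k _|_] /=; last first.
      by rewrite /pow /power sum_mix /= rtrD !rtrZ; ring.
    rewrite /sinr_slack /= rtrD !rtrZ.
    under eq_bigr do rewrite rtrD !rtrZ.
    by rewrite big_split/= -!mulr_sumr; ring.
  by rewrite /obj /energy sum_mix /= rtrD !rtrZ; ring.
have [|l [l0 [i li] lf]] := fritz_john Dc fa.
  move=> [W' WE'] [/= W'p WE'p] fpos.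
  have objpos : 0 < obj (W', WE').
    by have := fpos ord0; rewrite /f unlift_none.
  have powpos : 0 < pow (W', WE').
    by have := fpos (lift ord0 ord0); rewrite /f liftK/= unlift_none.
  have := best W' WE'; rewrite sdr2_feasibleP// => best'.
  have /best' : (forall i, 0 <= sinr_slack W' i) /\ power W' WE' <= Pmax.
    split=> [i|]; last by rewrite -subr_ge0; exact: ltW.
    by have := fpos (lift ord0 (lift ord0 i)); rewrite /f liftK/= liftK => /ltW.
  have objE X XE : complex.Re (sdr2_objective G X XE) = energy X XE.
    by rewrite /sdr2_objective ReD Re_sum.
  by rewrite lecE !objE => /andP[_]; move: objpos; rewrite /obj/=; lra.
exists (l ord0), (l (lift ord0 ord0)), (fun k => l (lift ord0 (lift ord0 k))).
split=> //.
  case: (unliftP ord0 i) li => [j ->|-> li]; last by constructor 1.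
  case: (unliftP ord0 j) => [k ->|-> li]; last by constructor 2.
  by move=> li; constructor 3; exists k.
move=> W' WE' W'p WE'p; have := lf (W', WE') (conj W'p WE'p).
rewrite !big_ord_recl /f unlift_none/= liftK/= unlift_none/=.
by under eq_bigr do rewrite liftK/= liftK/=.
Qed.

End optimum.
End sdr2.

(** The matrix [G] enters through its form alone: [xi] is the maximum of the Rayleigh quotient,
    attained only on multiples of [v]. *)
Lemma sdr2_optimal_rank1 (R : realType) M KI (h : 'I_KI -> 'rV[R[i]]_M)
    (sigma2 gamma : 'I_KI -> R) (Pmax : R) (G : 'M[R[i]]_M) (xi : R)
    (v : 'cV[R[i]]_M) W WE :
  (forall i, 0 < sigma2 i) -> (forall i, 0 < gamma i) ->
  0 < xi -> norm2 v = 1 -> qf G v = xi ->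
  (forall x, qf G x <= xi * norm2 x) ->
  (forall x, qf G x = xi * norm2 x -> exists c, x = c *: v) ->
  (forall i, ev (h i) v != 0) ->
  ~ aligned_feasible h sigma2 gamma Pmax v ->
  sdr2_optimal h sigma2 gamma Pmax G W WE ->
  [/\ forall i, \rank (W i) = 1%N,
      (\rank WE <= 1)%N &
      exists q : R, [/\ 0 <= q, q <= Pmax & WE = q%:C *: (v *m v^t*)]].
Proof.
move=> s0 g0 xi0 nv Gv Gle Geq hv naligned opt.
have [mu [beta [lam [[mu0 beta0] lam0 nz L0]]]] := sdr2_multipliers opt.
case: (opt) => feas _; have [_ _ Wp WEp] := feas.
have [slack0 powP] := (sdr2_feasibleP h sigma2 gamma Pmax Wp WEp).1 feas.
pose b i (x : 'cV[R[i]]_M) : R := marginal h gamma G mu beta lam i (x *m x^t*).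
pose n i (x : 'cV[R[i]]_M) := interference_form h G mu beta lam i x.
have bE i x : b i x = n i x + lam i / gamma i * sqmod (ev (h i) x).
  exact: marginal_outer.
pose cst := beta * Pmax - \sum_i lam i * sigma2 i - mu * energy G W WE.
pose m i := marginal h gamma G mu beta lam i.
pose mE := marginalE G mu beta.
have LE W' WE' : (forall i, psdmx (W' i)) -> psdmx WE' ->
    \sum_i m i (W' i) + mE WE' + cst <= 0.
  move=> W'p WE'p; have := L0 W' WE' W'p WE'p; rewrite mulrBr.
  have := lagrangianE h sigma2 gamma Pmax G mu beta lam W' WE'.
  by rewrite /cst /m /mE; lra.
(* The slacks of the optimum are nonnegative, hence so is the Lagrangian there. *)
have Lopt : \sum_i m i (W i) + mE WE + cst = 0.
  apply/eqP; rewrite eq_le LE//=.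
  have := lagrangianE h sigma2 gamma Pmax G mu beta lam W WE.
  have : 0 <= beta * (Pmax - power W WE) by rewrite mulr_ge0 ?subr_ge0.
  have : 0 <= \sum_i lam i * sinr_slack h sigma2 gamma W i.
    by apply: sumr_ge0 => i _; rewrite mulr_ge0.
  by rewrite /cst /m /mE; lra.
(* The other terms are homogeneous of degree 1: evaluating at the zero point gives [cst <= 0], and
   at twice the optimum [0 <= cst]. *)
have cst0 : cst = 0.
  have := LE (fun=> 0) 0 (fun=> psd0) psd0.
  have := LE (fun i => 2%:C *: W i) (2%:C *: WE)
    (fun i => psd_scale (ler0n R 2) (Wp i)) (psd_scale (ler0n R 2) WEp).
  have m0 i : m i 0 = 0 by rewrite -(scale0r 0) /m marginalZ mul0r.
  have mE0 : mE 0 = 0 by rewrite -(scale0r 0) /mE marginalEZ mul0r.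
  under eq_bigr do rewrite /m marginalZ -/(m _).
  under [in X in _ -> X -> _]eq_bigr do rewrite m0.
  rewrite big1_eq mE0 /mE marginalEZ -/(mE _) -mulr_sumr.
  by move: Lopt; lra.
have pert i k x : psdmx (W i + k%:C *: (x *m x^t*)) -> k * b i x <= 0.
  move=> Wxp; pose W' j := if j == i then W i + k%:C *: (x *m x^t*) else W j.
  have W'p j : psdmx (W' j) by rewrite /W'; case: (j == i); [exact: Wxp|exact: Wp].
  have := LE W' WE W'p WEp; rewrite (bigD1 i)//= {1}/W' eqxx.
  rewrite (eq_bigr (fun j => m j (W j))) => [|j /negbTE ji]; last first.
    by rewrite /W' ji.
  rewrite {1}/m marginalD marginalZ -/(b i x) -/(m i _).
  by move: Lopt; rewrite (bigD1 i)//=; lra.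
have pertE k x : psdmx (WE + k%:C *: (x *m x^t*)) ->
    k * (mu * qf G x - beta * norm2 x) <= 0.
  move=> Wxp; have := LE W _ Wp Wxp; rewrite /mE marginalED marginalEZ.
  by rewrite marginalE_outer -/(mE WE); move: Lopt; lra.
have b_le0 i x : b i x <= 0.
  by rewrite -[b i x]mul1r; apply: pert; exact: psdD (Wp i) (psd_outer _ ler01).
have bE_le0 x : mu * qf G x - beta * norm2 x <= 0.
  rewrite -[X in X <= _]mul1r; apply: pertE.
  exact: psdD WEp (psd_outer _ ler01).
(* If [beta = 0], the bound at [v] gives [mu = 0]; then [cst = 0] with positive noise kills every
   [lam i], and no multiplier is left. *)
have beta_gt0 : 0 < beta.
  rewrite lt_neqAle beta0 andbT eq_sym; apply/eqP => beta_eq0.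
  have mu_eq0 : mu = 0.
    apply/eqP; rewrite eq_le mu0 andbT -(pmulr_lle0 _ xi0).
    by have := bE_le0 v; rewrite Gv beta_eq0; lra.
  have sum0 : \sum_i lam i * sigma2 i = 0.
    by move: cst0; rewrite /cst beta_eq0 mu_eq0; lra.
  have lam_eq0 i : lam i = 0.
    have /allP/(_ i) : all (fun i => lam i * sigma2 i == 0) (index_enum 'I_KI).
      move/eqP: sum0; rewrite psumr_eq0// => j _.
      by rewrite mulr_ge0// ltW.
    rewrite mem_index_enum => /(_ isT); rewrite mulf_eq0 (gt_eqF (s0 i)) orbF.
    by move/eqP.
  case: nz => [||[k]]; first by rewrite mu_eq0 eqxx.
    by rewrite beta_eq0 eqxx.
  by rewrite lam_eq0 eqxx.
have beta_ge : mu * xi <= beta.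
  by have := bE_le0 v; rewrite Gv nv; lra.
(* Both signs of the perturbation along [u r] are admissible, so the form vanishes there. *)
have null i r e u : spectral_resolution (W i) e u -> e r != 0 -> b i (u r) = 0.
  move=> Weu er; apply/eqP; rewrite eq_le b_le0/=.
  have e0 := resolution_gt0 Weu er.
  rewrite -(pmulr_rge0 _ e0) -oppr_le0 -mulNr; apply: pert.
  by rewrite rmorphN scaleNr; exact: psd_resolutionB Weu.
have nullE r e u : spectral_resolution WE e u -> e r != 0 ->
    mu * qf G (u r) = beta.
  move=> Weu er; have e0 := resolution_gt0 Weu er.
  have := bE_le0 (u r); rewrite (resolution_norm2 Weu) mulr1.
  have : - e r * (mu * qf G (u r) - beta * norm2 (u r)) <= 0.
    by apply: pertE; rewrite rmorphN scaleNr; exact: psd_resolutionB Weu.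
  rewrite mulNr oppr_le0 pmulr_rge0// (resolution_norm2 Weu); lra.
have WEq : exists2 q : R, 0 <= q & WE = q%:C *: (v *m v^t*).
  have [e [u Weu]] := psd_spectral_resolution WEp.
  apply: (resolution_aligned Weu) => r er; apply: Geq.
  have := nullE _ _ _ Weu er; have := Gle (u r).
  rewrite (resolution_norm2 Weu) => ? ?.
  have mu_gt0 : 0 < mu.
    by rewrite lt_neqAle mu0 andbT; apply/eqP => mu_eq0; move: beta_gt0; nra.
  by nra.
have rankWE : (\rank WE <= 1)%N.
  case: WEq => q _ ->.
  by rewrite scalemxAr (leq_trans (mxrankM_maxl _ _))// rank_leq_col.
have n_lt0 i x : x != 0 -> n i x < 0.
  move=> x0; have nx := norm2_gt0 x0.
  have S0 y : 0 <= \sum_(k | k != i) lam k * sqmod (ev (h k) y).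
    by apply: sumr_ge0 => k _; rewrite mulr_ge0 ?sqmod_ge0.
  have muG : mu * qf G x <= mu * (xi * norm2 x) by exact: ler_wpM2l.
  rewrite /n /interference_form.
  have [beta_lt|beta_le|betaE] := ltgtP (mu * xi) beta; last 1 first.
  - have mu_gt0 : 0 < mu.
      by rewrite lt_neqAle mu0 andbT; apply/eqP => mu_eq0; move: beta_gt0; nra.
    have [[k ki lamk]|nolam] :=
      pselect (exists2 k, k != i & lam k != 0); last first.
      exfalso.
      have lam_eq0 k : k != i -> lam k = 0.
        by move=> ki; apply/eqP/negP => /negP lamk; apply: nolam; exists k.
      have Si y : \sum_(k | k != i) lam k * sqmod (ev (h k) y) = 0.
        by rewrite big1 // => k /lam_eq0 ->; rewrite mul0r.
      (* At [v] the form [b i] reduces to its own channel term, which is nonpositive although [h i]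
         does not annihilate [v]. *)
      have lami : lam i = 0.
        apply/eqP; rewrite eq_le lam0 andbT.
        have := b_le0 i v; rewrite bE /n /interference_form Si Gv nv.
        have -> : mu * xi - beta * 1 - 0 = 0 by lra.
        rewrite add0r pmulr_lle0 ?sqmod_gt0//.
        by rewrite pmulr_lle0// invr_gt0.
      have lam_all k : lam k = 0 by have [->|/lam_eq0] := eqVneq k i.
      (* With every [lam] equal to 0, isotropic vectors of [b j] attain the Rayleigh maximum of [G],
         hence are multiples of [v]. *)
      have Wal j : exists q : R, 0 <= q /\ W j = q%:C *: (v *m v^t*).
        have [e [u Weu]] := psd_spectral_resolution (Wp j).
        have [|q q0 ->] := @resolution_aligned _ _ _ _ _ Weu v; last by exists q.
        move=> r er; apply: Geq; have := null _ _ _ _ Weu er.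
        rewrite bE /n /interference_form lam_all !mul0r addr0 big1.
          by rewrite (resolution_norm2 Weu) -betaE; nra.
        by move=> k _; rewrite lam_all mul0r.
      have [p pE] := choice Wal.
      apply: naligned; exists p; split=> [j||j]; first by have [] := pE j.
      + apply: le_trans powP; rewrite /power.
        have := rtr1_ge0 WEp.
        have -> : \sum_j rtr 1%:M (W j) = \sum_j p j.
          apply: eq_bigr => j _; have [_ ->] := pE j.
          by rewrite rtrZ rtr_outer qf_scalar nv mulr1.
        lra.
      + have gE : gain (h j) v = (sqmod (ev (h j) v))%:C by rewrite sqmodE.
        rewrite gE; under eq_bigr do rewrite -rmorphM/=.
        rewrite -rmorphM -rmorph_sum -rmorphD -fmorphV -rmorphM lecR.
        have den : 0 < \sum_(k | k != j) p k * sqmod (ev (h j) v) + sigma2 j.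
          rewrite ltr_wpDl//; apply: sumr_ge0 => k _.
          by rewrite mulr_ge0 ?sqmod_ge0//; have [] := pE k.
        rewrite ler_pdivlMr//.
        have := slack0 j; rewrite /sinr_slack; have [_ ->] := pE j.
        rewrite rtrZ rtr_outer qf_hh.
        under eq_bigr => k _ do rewrite (proj2 (pE k)) rtrZ rtr_outer qf_hh.
        by rewrite -addrA -opprD subr_ge0 ler_pdivlMr// mulrC.
    (* A nonnegative value would make [x] a nonzero multiple of [v], where the interference term of
       user [k] is strictly positive. *)
    rewrite ltNge; apply/negP => n_ge0.
    have Sx := S0 x.
    have [|c xE] := Geq x.
      by apply/eqP; rewrite eq_le Gle/= -(ler_pM2l mu_gt0) mulrA betaE; lra.
    have c0 : c != 0 by apply: contraNneq x0; rewrite xE => ->; rewrite scale0r.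
    have lamk0 : 0 < lam k by rewrite lt_neqAle eq_sym lamk lam0.
    have : 0 < lam k * sqmod (ev (h k) x).
      by rewrite mulr_gt0// sqmod_gt0 xE evZ mulf_neq0.
    have : 0 <= \sum_(j | (j != i) && (j != k)) lam j * sqmod (ev (h j) x).
      by apply: sumr_ge0 => j _; rewrite mulr_ge0 ?sqmod_ge0.
    move: n_ge0; rewrite (bigD1 k)//= -betaE; move: muG; rewrite mulrA; lra.
  - have := S0 x; have : mu * xi * norm2 x < beta * norm2 x by rewrite ltr_pM2r.
    by move: muG; rewrite mulrA; lra.
  - by move: beta_ge; rewrite leNgt beta_le.
split=> // [i|]; last first.
  case: WEq => q q0 WEE; exists q; split=> //.
  apply: le_trans powP; rewrite /power [in leRHS]WEE rtrZ rtr_outer qf_scalar nv.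
  rewrite mulr1 lerDr; apply: sumr_ge0 => i _.
  exact: rtr1_ge0 (Wp i).
have [e [u Weu]] := psd_spectral_resolution (Wp i).
apply/eqP; rewrite eqn_leq; apply/andP; split.
  apply: (@isotropic_resolution_rank1 _ _ _ _ _ (b i) (n i) _ _ Weu
    (quadratic_marginal _ _ _ _ _ _ _) (bE i) (b_le0 i) (n_lt0 i)).
  by move=> r; exact: null Weu.
(* A zero matrix would leave the SINR slack at most [- sigma2 i]. *)
rewrite lt0n mxrank_eq0; apply/eqP => Wi0; have := slack0 i.
rewrite /sinr_slack Wi0 {1}/rtr mulmx0 mxtrace0 mul0r sub0r leNgt.
move=> /negP; apply.
rewrite -opprD oppr_lt0 ltr_wpDl//; apply: sumr_ge0 => k _.
exact: rtr_hh_ge0 (Wp k).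
Qed.

(** * Simplicity of the top eigenvalue *)

Section decay.
Context {R : realType} {M : nat}.
Local Notation C := R[i].
Implicit Types (h : 'rV[C]_M) (A : 'M[C]_M) (e : 'I_M -> R)
  (u : 'I_M -> 'cV[C]_M).

(* For A >= 0 this says that the row h is orthogonal to the top eigenspace of
   A: h A^n h^H then grows at a smaller exponential rate than tr A^n.  Only
   countably many polynomial conditions are involved, whence measurability. *)
Definition decaying h A := forall k : nat, exists n : nat,
  k%:R * complex.Re ((h *m A ^+ n *m h^t*) 0 0) < complex.Re (\tr (A ^+ n)).

(** The trace is at most [M * e r0 ^+ n], so one top eigenvector seen by [h] bounds the ratio of
    trace to row form. Conversely, if [h] sees none, the ratios [(e r / e r0) ^+ n] that remain tend
    to 0. *)
Lemma decayingP A e u h r0 : spectral_resolution A e u ->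
  (forall r, e r <= e r0) ->
  decaying h A <-> (forall r, e r = e r0 -> ev h (u r) = 0).
Proof.
move=> Aeu top; have e_ge0 r : 0 <= e r by case: Aeu.
have rowE n : complex.Re ((h *m A ^+ n *m h^t*) 0 0) =
    \sum_r e r ^+ n * sqmod (ev h (u r)) by rewrite (resolution_row Aeu).
have trE n : complex.Re (\tr (A ^+ n)) = \sum_r e r ^+ n.
  by rewrite (resolution_tr Aeu).
split=> [dec r er|ortho k].
  apply/eqP; rewrite -sqmod_eq0 eq_le sqmod_ge0 andbT leNgt; apply/negP => s0.
  pose k := (Num.truncn (M%:R / sqmod (ev h (u r)))).+1.
  have kE : M%:R < k%:R * sqmod (ev h (u r)).
    by rewrite -ltr_pdivrMr//; exact: truncnS_gt.
  have [n] := dec k; rewrite rowE trE; apply/negP; rewrite -leNgt.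
  have : \sum_s e s ^+ n <= M%:R * e r ^+ n.
    rewrite -[M in leRHS]card_ord mulr_natl -sumr_const.
    by apply: ler_sum => s _; rewrite er lerXn2r ?nnegrE.
  move=> /le_trans -> //.
  rewrite (bigD1 r)//= mulrDr.
  rewrite (@le_trans _ _ (k%:R * (e r ^+ n * sqmod (ev h (u r)))))//.
    by rewrite mulrCA mulrC ler_wpM2l ?exprn_ge0// ltW.
  rewrite lerDl mulr_ge0// sumr_ge0// => s _.
  by rewrite mulr_ge0 ?exprn_ge0 ?sqmod_ge0.
(* If the top eigenvalue is 0, every eigenvector is a top one and [h] is orthogonal to all; the
   exponent 0 works, since [A ^+ 0] has trace [M]. *)
have [e0|e0] := eqVneq (e r0) 0.
  exists 0; rewrite rowE trE big1 ?mulr0.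
    rewrite (eq_bigr (fun=> 1)) ?sumr_const ?card_ord ?ltr0n//.
    exact: leq_ltn_trans (ltn_ord r0).
  move=> r _; rewrite ortho; last first.
    by apply/eqP; rewrite eq_le top e0 e_ge0.
  by apply/eqP; rewrite mulf_eq0 sqmod_eq0 eqxx orbT.
have er0 : 0 < e r0 by rewrite lt_neqAle eq_sym e0 e_ge0.
have : (\sum_r k%:R * sqmod (ev h (u r)) * (e r / e r0) ^+ n : R)
    @[n --> \oo] --> \sum_(r < M) (0 : R).
  apply: cvg_big => [|r _]; first exact: add_continuous.
  have [err|err] := eqVneq (e r) (e r0).
    rewrite ortho// sqmod0.
    by under eq_fun do rewrite mulr0 mul0r; exact: cvg_cst.
  apply: cvg_geometric.
  by rewrite ger0_norm ?divr_ge0// ltr_pdivrMr// mul1r lt_neqAle err top.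
rewrite big1// => /cvgr_lt/(_ _ ltr01)[n _ /(_ n (leqnn n))] lt1.
exists n; rewrite rowE trE (@lt_le_trans _ _ (e r0 ^+ n))//; last first.
  by rewrite (bigD1 r0)//= lerDl sumr_ge0// => r _; rewrite exprn_ge0.
rewrite mulr_sumr -[ltRHS]mul1r -ltr_pdivrMr ?exprn_gt0// mulr_suml.
apply: le_lt_trans lt1; apply: ler_sum => r _.
by rewrite expr_div_n le_eqVlt; apply/orP; left; apply/eqP; ring.
Qed.

Lemma resolution_top (m0 : (0 < M)%N) e : exists r0, forall r, e r <= e r0.
Proof.
have [r0 _ top] := arg_maxP e (isT : predT (Ordinal m0)).
by exists r0 => r; exact: top.
Qed.

Lemma not_decaying_top A e u h : (0 < M)%N -> spectral_resolution A e u ->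
  ~ decaying h A ->
  exists r, (forall s, e s <= e r) /\ ev h (u r) != 0.
Proof.
move=> m0 Aeu ndec; have [r0 top] := resolution_top m0 e.
have [//|noex] := pselect (exists r, (forall s, e s <= e r) /\ ev h (u r) != 0).
case: ndec; apply/(decayingP h Aeu top) => r er; apply/eqP/negP => /negP hr.
by apply: noex; exists r; rewrite er.
Qed.

Lemma resolution_qf_le A e u t x : spectral_resolution A e u ->
  (forall r, e r <= t) -> qf A x <= t * norm2 x.
Proof.
move=> Aeu et; rewrite (resolution_qf Aeu) (resolution_sum_norm2 Aeu) mulr_sumr.
by apply: ler_sum => r _; rewrite ler_wpM2r ?sqmod_ge0.
Qed.

Lemma qf_eigen A t x : A *m x = t%:C *: x -> qf A x = t * norm2 x.
Proof.
by move=> Ax; rewrite /qf -mulmxA Ax -scalemxAr mxE adj_mul_self -rmorphM.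
Qed.

Lemma resolution_qf_eq A e u t x : spectral_resolution A e u ->
  (forall r, e r <= t) -> qf A x = t * norm2 x -> A *m x = t%:C *: x.
Proof.
move=> Aeu et; rewrite (resolution_qf Aeu) (resolution_sum_norm2 Aeu) mulr_sumr.
move/esym/eqP; rewrite -subr_eq0 -sumrB psumr_eq0 => [/allP eq0|r _]; last first.
  by rewrite -mulrBl mulr_ge0 ?sqmod_ge0// subr_ge0.
case: (Aeu) => _ _ oneE AE.
rewrite -[in RHS](mul1mx x) oneE [in LHS]AE !mulmx_suml scaler_sumr.
apply: eq_bigr => r _; have := eq0 r (mem_index_enum r).
rewrite -mulrBl mulf_eq0 subr_eq0 sqmod_eq0 => /orP[/eqP->|/eqP ux].
  by rewrite -scalemxAl.
have Px : u r *m (u r)^t* *m x = 0.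
  rewrite -mulmxA; have -> : (u r)^t* *m x = 0; last by rewrite mulmx0.
  apply/matrixP => i j; rewrite !ord1 [RHS]mxE.
  by rewrite -[x]trmxCK mul_adj_col ux rmorph0.
by rewrite -scalemxAl Px !scaler0.
Qed.

Lemma dominant_unit_eigenvectorP A e u r0 v : spectral_resolution A e u ->
  (forall r, e r <= e r0) -> dominant_unit_eigenvector A v ->
  norm2 v = 1 /\ A *m v = (e r0)%:C *: v.
Proof.
move=> Aeu top [xi [[_ xi_max] Av v1]].
have nv : norm2 v = 1 by apply: complexI; rewrite -sqnormE v1.
have er_xi : (e r0)%:C <= xi.
  apply: xi_max; apply/eigenvalueP; exists ((u r0)^t*).
    (* The predicate [eigenvalue] asks for a row eigenvector; for Hermitian [A] the adjoint of
       [u r0] is one. *)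
    have Ah : A^t* = A.
      case: (Aeu) => _ _ _ ->; rewrite raddf_sum/= map_mx_sum.
      apply: eq_bigr => r _.
      by rewrite adjmxZ adjmx_mul trmxCK conj_Creal// complex_real.
    rewrite -[A in LHS]Ah -adjmx_mul (resolution_eigen Aeu) adjmxZ.
    by rewrite conj_Creal// complex_real.
  apply: contra (resolution_neq0 Aeu r0) => /eqP ut0.
  by rewrite -[u r0]trmxCK ut0; apply/eqP/matrixP => i j; rewrite !mxE rmorph0.
have xiE : xi = (complex.Re xi)%:C.
  by apply: ge0_RRe; apply: le_trans er_xi; rewrite lecR; case: Aeu.
have Av' : A *m v = (complex.Re xi)%:C *: v by rewrite -xiE.
split=> //; rewrite Av'; congr (_%:C *: _); apply/eqP; rewrite eq_le.
apply/andP; split; last by rewrite -lecR -xiE.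
by have := resolution_qf_le v Aeu top; rewrite (qf_eigen Av') nv !mulr1.
Qed.

(* As g is not orthogonal to the top eigenspace of A, the update strictly raises
   the top eigenvalue; a top eigenvector of A + c g^H g orthogonal to g would be
   an eigenvector of A beyond the spectrum of A, so the new top eigenspace meets
   the hyperplane orthogonal to g trivially. *)
Lemma rank1_update_simple A A' (c : R) e' u' r0 (g : 'rV[C]_M)
    (x y : 'cV[C]_M) :
  (0 < M)%N -> psdmx A -> 0 < c -> A' = A + c%:C *: (g^t* *m g) ->
  ~ decaying g A -> spectral_resolution A' e' u' -> (forall r, e' r <= e' r0) ->
  x != 0 -> A' *m x = (e' r0)%:C *: x -> A' *m y = (e' r0)%:C *: y ->
  exists k, y = k *: x.
Proof.
move=> m0 /psd_spectral_resolution[e [u Aeu]] c0 AE ndec A'eu top x0 Ax Ay.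
have [r [rtop gur]] := not_decaying_top m0 Aeu ndec.
have lt_top : e r < e' r0.
  have := resolution_qf_le (u r) A'eu top.
  rewrite (resolution_norm2 Aeu) mulr1; apply: lt_le_trans.
  have -> : qf A' (u r) = e r + c * sqmod (ev g (u r)).
    have := qf_eigen (resolution_eigen Aeu r); rewrite (resolution_norm2 Aeu).
    rewrite mulr1 => <-; rewrite /qf AE mulmxDr mulmxDl mxE ReD; congr (_ + _).
    rewrite -scalemxAr -scalemxAl mxE Re_realM; congr (_ * _).
    exact: qf_gram.
  by rewrite ltrDl mulr_gt0// sqmod_gt0.
have null z : A' *m z = (e' r0)%:C *: z -> ev g z = 0 -> z = 0.
  move=> Az gz; apply/eqP/negP => /negP z0.
  have : A *m z = (e' r0)%:C *: z.
    rewrite -Az AE mulmxDl -scalemxAl -mulmxA.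
    have -> : g *m z = 0; last by rewrite mulmx0 scaler0 addr0.
    by apply/matrixP => i j; rewrite !ord1 [RHS]mxE.
  move=> /qf_eigen qz; have := resolution_qf_le z Aeu rtop.
  by rewrite qz ler_pM2r ?norm2_gt0// leNgt lt_top.
have gx : ev g x != 0 by apply: contra x0 => /eqP gx; apply/eqP/null.
exists (ev g y / ev g x); apply/eqP; rewrite -subr_eq0; apply/eqP/null.
  by rewrite mulmxBr -scalemxAr Ax Ay scalerBr !scalerA mulrC.
by rewrite evB evZ divfK// subrr.
Qed.

Lemma psd_gram c h : 0 <= c -> psdmx (c%:C *: (h^t* *m h)).
Proof. by move=> c0; have := psd_outer (h^t*) c0; rewrite trmxCK. Qed.

End decay.

Lemma two_columns_not_aligned (F : fieldType) M (v : 'cV[F]_M) :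
  (1 < M)%N -> ~ (forall x : 'cV[F]_M, exists c, x = c *: v).
Proof.
move=> M1 span; pose i0 := Ordinal (ltnW M1); pose i1 := Ordinal M1.
have [c0 E0] := span (delta_mx i0 0); have [c1 E1] := span (delta_mx i1 0).
have /matrixP/(_ i0 0) := E0; have /matrixP/(_ i1 0) := E0.
have /matrixP/(_ i0 0) := E1; have /matrixP/(_ i1 0) := E1.
rewrite !mxE !eqxx/= => H1 /esym/eqP; rewrite mulf_eq0 => /orP[|] /eqP Z.
  by move: H1; rewrite Z mul0r => /eqP; rewrite oner_eq0.
by rewrite Z mulr0 => _ /eqP; rewrite oner_eq0.
Qed.

Lemma sdr2_optimal_structure (R : realType) M KI KE (zeta : R)
    (alpha : 'I_KE -> R) (h : 'I_KI -> 'rV[R[i]]_M) (g : 'I_KE -> 'rV[R[i]]_M)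
    (sigma2 gamma : 'I_KI -> R) (Pmax : R) j0 v W WE :
  (1 < M)%N -> (forall i, 0 < sigma2 i) -> (forall i, 0 < gamma i) ->
  (forall j, 0 <= alpha j) -> 0 < alpha j0 -> 0 < zeta ->
  let G := energy_matrix zeta alpha g in
  ~ decaying (g j0)
      (\sum_(j | j != j0) (zeta * alpha j)%:C *: ((g j)^t* *m g j)) ->
  (forall i, ~ decaying (h i) G) ->
  dominant_unit_eigenvector G v ->
  ~ aligned_feasible h sigma2 gamma Pmax v ->
  sdr2_optimal h sigma2 gamma Pmax G W WE ->
  [/\ forall i, \rank (W i) = 1%N,
      (\rank WE <= 1)%N &
      exists q : R, [/\ 0 <= q, q <= Pmax & WE = q%:C *: (v *m v^t*)]].
Proof.
move=> M1 s0 g0 a0 aj0 z0 G ndecg ndech domv naligned opt.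
have M0 : (0 < M)%N by exact: ltnW.
have GE : G = \sum_j (zeta * alpha j)%:C *: ((g j)^t* *m g j).
  rewrite /G /energy_matrix scaler_sumr; apply: eq_bigr => j _.
  by rewrite scalerA -rmorphM.
have gp j : psdmx ((zeta * alpha j)%:C *: ((g j)^t* *m g j)).
  by apply: psd_gram; rewrite mulr_ge0// ltW.
have Hp := psd_sum (Q := fun j => j != j0) (fun j _ => gp j).
have Gp : psdmx G by rewrite GE; exact: psd_sum.
have [e [u Geu]] := psd_spectral_resolution Gp.
have [r0 top] := resolution_top M0 e.
have [nv Gv] := dominant_unit_eigenvectorP Geu top domv.
have v0 : v != 0.
  apply/eqP => v0; move: nv; rewrite v0 /norm2 big1.
    by move/esym/eqP; rewrite oner_eq0.
  by move=> k _; apply/eqP; rewrite sqmod_eq0 mxE.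
have simple y : G *m y = (e r0)%:C *: y -> exists k, y = k *: v.
  have GHE : G = \sum_(j | j != j0) (zeta * alpha j)%:C *: ((g j)^t* *m g j)
      + (zeta * alpha j0)%:C *: ((g j0)^t* *m g j0).
    by rewrite GE (bigD1 j0)//= addrC.
  exact: (rank1_update_simple M0 Hp (mulr_gt0 z0 aj0) GHE ndecg Geu top v0 Gv).
have Gle x := resolution_qf_le x Geu top.
have Geq x : qf G x = e r0 * norm2 x -> exists c, x = c *: v.
  by move=> qx; apply/simple/(resolution_qf_eq Geu top).
(* If the top eigenvalue were 0, every vector would attain it, contradicting simplicity in dimension
   at least 2. *)
have er0 : 0 < e r0.
  have e_ge0 r : 0 <= e r by case: Geu.
  rewrite lt_neqAle e_ge0 andbT eq_sym; apply/eqP => e0.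
  apply: (two_columns_not_aligned (v := v) M1) => x; apply: Geq.
  apply/eqP; rewrite eq_le Gle/= e0 mul0r (resolution_qf Geu).
  by apply: sumr_ge0 => r _; rewrite mulr_ge0 ?sqmod_ge0.
(* Some top eigenvector is not annihilated by [h i], and by simplicity it is a multiple of [v]. *)
have hv i : ev (h i) v != 0.
  have [r [rtop hu]] := not_decaying_top M0 Geu (ndech i).
  have er : e r = e r0 by apply/eqP; rewrite eq_le top rtop.
  have [|k uE] := simple (u r); first by rewrite (resolution_eigen Geu) er.
  by apply: contra hu => /eqP hv; rewrite uE evZ hv mulr0.
apply: (sdr2_optimal_rank1 s0 g0 er0 nv _ Gle Geq hv naligned opt).
by rewrite (qf_eigen Gv) nv mulr1.
Qed.

(** * Almost sure properties *)

Section lebesgue_hyperplane.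
Context {R : realType}.
Local Notation mR := (measurableTypeR R).

Lemma measurable_linear_form n (a : 'I_n -> R) :
  measurable_fun setT (fun t : n.-tuple mR => \sum_i a i * tnth t i : R).
Proof.
apply: measurable_sum => i; apply: measurable_funM; first exact: measurable_cst.
exact: measurable_tnth.
Qed.

(** By induction and Fubini: if the first coefficient vanishes, the sections at fixed first
    coordinate are lower-dimensional hyperplanes. *)
Lemma lebesgue_tuple_hyperplane n (a : 'I_n -> R) c : (exists i, a i != 0) ->
  lebesgue_tuple n [set t | \sum_i a i * tnth t i = c] = 0%E.
Proof.
elim: n a c => [|n IHn] a c [i ai]; first by case: i ai.
set B := [set t | _].
pose B' : set (mR * n.-tuple mR) := [set p | a ord0 * p.1 +
  \sum_i a (lift ord0 i) * tnth p.2 i = c].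
have BE : (@tuple_cons R n) @^-1` B = B'.
  have sumE p : \sum_i a i * tnth (@tuple_cons R n p) i =
      a ord0 * p.1 + \sum_i a (lift ord0 i) * tnth p.2 i.
    rewrite big_ord_recl; congr (_ + _).
    by apply: eq_bigr => j _; congr (_ * _); exact: tnthS.
  by apply/seteqP; split=> p; rewrite /B /B' /preimage/= sumE.
have mB' : measurable B'.
  rewrite -[X in measurable X]setTI.
  have mf : measurable_fun setT (fun p : mR * n.-tuple mR => a ord0 * p.1 +
      \sum_i a (lift ord0 i) * tnth p.2 i : R).
    apply: measurable_funD.
      by apply: measurable_funM; [exact: measurable_cst|exact: measurable_fst].
    exact: (measurableT_comp (measurable_linear_form _) measurable_snd).
  exact: (mf measurableT [set c]).
rewrite /= /prod_image /pushforward BE.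
have [a0|a0] := eqVneq (a ord0) 0.
  have [j aj] : exists j, a (lift ord0 j) != 0.
    by case: (unliftP ord0 i) ai => [j ->|->]; [exists j|rewrite a0 eqxx].
  rewrite /product_measure1 integral0_eq// => x _ /=.
  rewrite -[RHS](IHn (fun j => a (lift ord0 j)) c); last by exists j.
  congr (lebesgue_tuple n _); apply/seteqP; split=> t;
    by rewrite /xsection /B' /= inE /= a0 mul0r add0r.
(* The order of integration is swapped, because the sections along the first coordinate are now
   single points. *)
rewrite (product_measure_unique
  (m' := (@lebesgue_measure R \x^ lebesgue_tuple n)%E))//=;
  last by move=> A1 A2 mA1 mA2; rewrite product_measure2E.
rewrite /product_measure2 integral0_eq// => y _ /=.
rewrite (_ : ysection B' y =
  [set (c - \sum_i a (lift ord0 i) * tnth y i) / a ord0]).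
  exact: lebesgue_measure_set1.
apply/seteqP; split=> x; rewrite /ysection /B' /= inE /=.
  by move=> <-; rewrite addrK mulrAC divff// mul1r.
by move=> ->; rewrite mulrCA divff// mulr1 subrK.
Qed.

End lebesgue_hyperplane.

(** * Measurability of complex matrix functions *)

Section complex_measurability.
Context {R : realType} d {T : measurableType d}.
Local Notation C := R[i].

Definition measurable_cfun (f : T -> C) :=
  measurable_fun setT (fun t => complex.Re (f t) : R) /\
  measurable_fun setT (fun t => complex.Im (f t) : R).

Lemma measurable_cfun_cst c : measurable_cfun (fun=> c).
Proof. by split; exact: measurable_cst. Qed.

Lemma measurable_cfunD f g : measurable_cfun f -> measurable_cfun g ->
  measurable_cfun (fun t => f t + g t).
Proof.
move=> [f1 f2] [g1 g2]; split.
  rewrite (_ : (fun t => _) = (fun t => complex.Re (f t) + complex.Re (g t))).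
    exact: measurable_funD.
  by apply/funext => t; case: (f t) (g t) => [? ?] [? ?].
rewrite (_ : (fun t => _) = (fun t => complex.Im (f t) + complex.Im (g t))).
  exact: measurable_funD.
by apply/funext => t; case: (f t) (g t) => [? ?] [? ?].
Qed.

Lemma measurable_cfunM f g : measurable_cfun f -> measurable_cfun g ->
  measurable_cfun (fun t => f t * g t).
Proof.
move=> [f1 f2] [g1 g2]; split.
  rewrite (_ : (fun t => _) = (fun t => complex.Re (f t) * complex.Re (g t)
      - complex.Im (f t) * complex.Im (g t))).
    by apply: measurable_funB; exact: measurable_funM.
  by apply/funext => t; case: (f t) (g t) => [? ?] [? ?].
rewrite (_ : (fun t => _) = (fun t => complex.Re (f t) * complex.Im (g t)
    + complex.Im (f t) * complex.Re (g t))).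
  by apply: measurable_funD; exact: measurable_funM.
by apply/funext => t; case: (f t) (g t) => [? ?] [? ?].
Qed.

Lemma measurable_cfun_conj f : measurable_cfun f ->
  measurable_cfun (fun t => (f t)^*%R).
Proof.
move=> [f1 f2]; split.
  rewrite (_ : (fun t => _) = (fun t => complex.Re (f t)))//.
  by apply/funext => t; case: (f t).
rewrite (_ : (fun t => _) = (fun t => - complex.Im (f t))).
  exact: measurable_funN.
by apply/funext => t; case: (f t).
Qed.

Lemma measurable_cfun_sum (I : finType) (Q : pred I) (f : I -> T -> C) :
  (forall i, Q i -> measurable_cfun (f i)) ->
  measurable_cfun (fun t => \sum_(i | Q i) f i t).
Proof.
move=> mf; rewrite (_ : (fun t => _) = \sum_(i | Q i) f i); last first.
  by apply/funext => t; rewrite fct_sumE.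
elim/big_rec: _ => [|i g Qi mg]; first exact: measurable_cfun_cst.
exact: measurable_cfunD (mf _ Qi) mg.
Qed.

Definition measurable_mxfun m n (A : T -> 'M[C]_(m, n)) :=
  forall i j, measurable_cfun (fun t => A t i j).

Lemma measurable_mxfunM m n p (A : T -> 'M[C]_(m, n)) (B : T -> 'M[C]_(n, p)) :
  measurable_mxfun A -> measurable_mxfun B ->
  measurable_mxfun (fun t => A t *m B t).
Proof.
move=> mA mB i j.
rewrite (_ : (fun t => _) = (fun t => \sum_k A t i k * B t k j)); last first.
  by apply/funext => t; rewrite mxE.
by apply: measurable_cfun_sum => k _; exact: measurable_cfunM.
Qed.

Lemma measurable_mxfun_adj m n (A : T -> 'M[C]_(m, n)) :
  measurable_mxfun A -> measurable_mxfun (fun t => (A t)^t*).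
Proof.
move=> mA i j; rewrite (_ : (fun t => _) = (fun t => (A t j i)^*%R)).
  exact: measurable_cfun_conj.
by apply/funext => t; rewrite !mxE.
Qed.

Lemma measurable_mxfunX n (A : T -> 'M[C]_n) k :
  measurable_mxfun A -> measurable_mxfun (fun t => A t ^+ k).
Proof.
move=> mA; elim: k => [|k IHk].
  by move=> i j; under eq_fun do rewrite expr0; exact: measurable_cfun_cst.
under eq_fun do rewrite exprS; exact: measurable_mxfunM.
Qed.

Lemma measurable_mxfunZ (c : C) m n (A : T -> 'M[C]_(m, n)) :
  measurable_mxfun A -> measurable_mxfun (fun t => c *: A t).
Proof.
move=> mA i j; rewrite (_ : (fun t => _) = (fun t => c * A t i j)).
  by apply: measurable_cfunM => //; exact: measurable_cfun_cst.
by apply/funext => t; rewrite mxE.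
Qed.

Lemma measurable_mxfun_sum (I : finType) (Q : pred I) m n
    (A : I -> T -> 'M[C]_(m, n)) : (forall i, Q i -> measurable_mxfun (A i)) ->
  measurable_mxfun (fun t => \sum_(i | Q i) A i t).
Proof.
move=> mA i j; rewrite (_ : (fun t => _) = (fun t => \sum_(k | Q k) A k t i j)).
  by apply: measurable_cfun_sum => k Qk; exact: mA.
by apply/funext => t; rewrite summxE.
Qed.

Lemma measurable_decaying M (h : T -> 'rV[C]_M) (A : T -> 'M[C]_M) :
  measurable_mxfun h -> measurable_mxfun A ->
  measurable [set t | decaying (h t) (A t)].
Proof.
move=> mh mA.
rewrite (_ : [set t | _] = \bigcap_k \bigcup_n [set t |
  k%:R * complex.Re ((h t *m A t ^+ n *m (h t)^t*) 0 0)
  < complex.Re (\tr (A t ^+ n))]); last first.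
  apply/seteqP; split=> t /= dec k; last by have [n _ ?] := dec k I; exists n.
  by move=> _; have [n ?] := dec k; exists n.
apply: bigcapT_measurable => k; apply: bigcupT_measurable => n.
have mf : measurable_fun setT (fun t =>
    k%:R * complex.Re ((h t *m A t ^+ n *m (h t)^t*) 0 0) : R).
  apply: measurable_funM; first exact: measurable_cst.
  by apply: (measurable_mxfunM (measurable_mxfunM mh (measurable_mxfunX n mA))
    (measurable_mxfun_adj mh) 0 0).1.
have mg : measurable_fun setT (fun t => complex.Re (\tr (A t ^+ n)) : R).
  by apply: (measurable_cfun_sum (fun i _ => measurable_mxfunX n mA i i)).1.
have := measurable_fun_ltr mf mg.
by move=> /(_ measurableT [set true] I); rewrite setTI.
Qed.

End complex_measurability.

Lemma measurable_cfun_comp (R : realType) d1 d2 (T1 : measurableType d1)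
    (T2 : measurableType d2) (f : T2 -> R[i]) (g : T1 -> T2) :
  measurable_cfun f -> measurable_fun setT g -> measurable_cfun (f \o g).
Proof.
by move=> [f1 f2] mg; split;
  [exact: (measurableT_comp f1 mg)|exact: (measurableT_comp f2 mg)].
Qed.

Section coordinates.
Context {R : realType} {M : nat}.
Local Notation mR := (measurableTypeR R).

Definition of_coords (t : (M + M).-tuple mR) : 'rV[R[i]]_M :=
  \row_m (tnth t (lshift M m) +i* tnth t (rshift M m)).

Lemma real_coordsK : cancel (@real_coords R M) of_coords.
Proof.
move=> x; apply/rowP => m; rewrite mxE /real_coords !tnth_map !tnth_ord_tuple.
rewrite (unsplitK (inl m)) (unsplitK (inr m)).
by case: (x 0 m).
Qed.

Lemma measurable_of_coords : measurable_mxfun of_coords.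
Proof.
move=> i m; rewrite ord1; split.
  by under eq_fun do rewrite mxE/=; exact: measurable_tnth.
by under eq_fun do rewrite mxE/=; exact: measurable_tnth.
Qed.

(** The real part of the complex equation already confines [t] to a real hyperplane, with
    coefficients [Re u] and [- Im u]. *)
Lemma lebesgue_tuple_ev (u : 'cV[R[i]]_M) : u != 0 ->
  exists N : set ((M + M).-tuple mR), [/\ measurable N,
    lebesgue_tuple (M + M) N = 0%E & [set t | ev (of_coords t) u = 0] `<=` N].
Proof.
move=> u0.
pose a k := match fintype.split k with
  | inl m => complex.Re (u m 0) | inr m => - complex.Im (u m 0) end.
have al m : a (lshift M m) = complex.Re (u m 0).
  by rewrite /a (unsplitK (inl m)).
have ar m : a (rshift M m) = - complex.Im (u m 0).
  by rewrite /a (unsplitK (inr m)).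
exists [set t | \sum_k a k * tnth t k = 0]; split.
- rewrite -[X in measurable X]setTI.
  by apply: (measurable_linear_form a measurableT (Y := [set 0 : R])).
- apply: lebesgue_tuple_hyperplane.
  have [//|noex] := pselect (exists i, a i != 0).
  case/eqP: u0; apply/matrixP => m j; rewrite ord1 mxE.
  have a0 k : a k = 0 by apply/eqP/negP => /negP ak; apply: noex; exists k.
  have := al m; have := ar m; rewrite !a0; case: (u m 0) => p q /=.
  by move=> /eqP; rewrite eq_sym oppr_eq0 => /eqP -> <-.
- move=> t /= tu.
  transitivity (complex.Re (ev (of_coords t) u)); last by rewrite tu.
  rewrite big_split_ord/= -big_split/= /ev mxE Re_sum; apply: eq_bigr => m _.
  rewrite al ar mxE; case: (u m 0) => p q /=; ring.
Qed.

End coordinates.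

(** * Independence of one channel from all the others *)

Section independence.
Context {R : realType} d {T : measurableType d} (P : probability T R).
Context {K : finType} {M : nat} (X : K -> T -> 'rV[R[i]]_M).
Hypothesis mX : forall k, measurable_fun setT (@real_coords R M \o X k).
Hypothesis indep : mutually_independent P X.
Variable k0 : K.

Let mXB k B : measurable B -> measurable ((@real_coords R M \o X k) @^-1` B).
Proof. by move=> mB; rewrite -[X in measurable X]setTI; exact: mX. Qed.

(** Cylinder events of the channels other than [k0]: a pi-system that generates their joint
    sigma-algebra. *)
Definition other_events : set (set T) := [set E | exists B : K -> set _,
  [/\ forall k, measurable (B k), B k0 = setT &
      E = \bigcap_(k in [set: K]) ((@real_coords R M \o X k) @^-1` B k)]].

Lemma other_events_setI : setI_closed other_events.
Proof.
move=> _ _ [B [mB B0 ->]] [B' [mB' B'0 ->]].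
exists (fun k => B k `&` B' k); split=> [k||]; first exact: measurableI.
  by rewrite B0 B'0 setTI.
apply/seteqP; split=> [w [wB wB'] k _|w wB].
  by split; [exact: wB|exact: wB'].
by split=> k kK; have [] := wB k kK.
Qed.

Lemma other_events_measurable : other_events `<=` measurable.
Proof.
move=> _ [B [mB _ ->]]; apply: fin_bigcap_measurable => [|k _].
  exact: finite_finset.
exact: mXB.
Qed.

Lemma other_eventsT : other_events setT.
Proof.
exists (fun=> setT); split=> //; by apply/seteqP; split.
Qed.

(** As functions of [E], both sides are finite measures that agree on the pi-system [other_events],
    hence on the sigma-algebra it generates. *)
Lemma independent_of_others B E : measurable B -> <<s other_events >> E ->
  P (E `&` (@real_coords R M \o X k0) @^-1` B) =
  (P ((@real_coords R M \o X k0) @^-1` B) * P E)%E.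
Proof.
move=> mB sE; have mXk := mXB k0 mB.
set XB := (X in P (E `&` X)) in mXk *.
have PXB0 : 0 <= fine (P XB) by rewrite fine_ge0.
have PXBE : (fine (P XB))%:E = P XB by rewrite fineK ?fin_num_measure.
have scaleE F : mscale (NngNum PXB0) P F = (P XB * P F)%E.
  by rewrite -[in RHS]PXBE.
rewrite -scaleE -[LHS]/(mrestr P mXk E).
have cover : \bigcup_(k : nat) (setT : set T) = setT.
  by apply/seteqP; split=> // w _; exists 0.
apply: (@g_sigma_algebra_measure_unique _ _ _ other_events
  other_events_measurable (fun=> setT) (fun=> other_eventsT) cover
  (mrestr P mXk) (mscale (NngNum PXB0) P) other_events_setI) => //.
- move=> _ [C [mC C0 ->]]; 
  rewrite -[RHS]/(mscale (NngNum PXB0) P _) scaleE -[LHS]/(P (_ `&` XB)).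
  (* Inserting [B] in the free slot [k0] turns the intersection into one to which mutual
     independence applies. *)
  pose C' k := if k == k0 then B else C k.
  have -> : \bigcap_(k in [set: K]) ((@real_coords R M \o X k) @^-1` C k)
      `&` XB = \bigcap_(k in [set: K]) ((@real_coords R M \o X k) @^-1` C' k).
    apply/seteqP; split=> [w [wC wB] k _|w wC'].
      by rewrite /C'; case: eqP => [->//|_]; exact: wC.
    split=> [k _|]; last by have := wC' k0 I; rewrite /C' eqxx.
    have := wC' k I; rewrite /C'; case: eqP => [->|//].
    by rewrite C0.
  rewrite indep; last by move=> k; rewrite /C'; case: eqP.
  rewrite indep// (bigD1 k0)//= {1}/C' eqxx; congr (_ * _)%E.
  rewrite [RHS](bigD1 k0)//= C0 preimage_setT probability_setT mul1e.
  by apply: eq_bigr => k /negbTE kk0; rewrite /C' kk0.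
- move=> _; rewrite -[X in (X < _)%E]/(P (setT `&` XB)) setTI ltey_eq.
  by rewrite fin_num_measure.
Qed.

Local Notation TF := (g_sigma_algebraType other_events).

Lemma measurable_id_others : measurable_fun setT (id : T -> TF).
Proof.
move=> _ B mB; rewrite setTI preimage_id.
exact: (smallest_sub (@sigma_algebra_measurable _ T) other_events_measurable).
Qed.

Lemma measurable_other_channel k : k != k0 ->
  measurable_mxfun (X k : TF -> 'rV[R[i]]_M).
Proof.
move=> kk0; have mc : measurable_fun setT (@real_coords R M \o X k : TF -> _).
  move=> _ B mB; rewrite setTI; apply: sub_sigma_algebra.
  exists (fun j => if j == k then B else setT); split=> [j||].
  - by case: eqP.
  - by rewrite eq_sym (negbTE kk0).
  - apply/seteqP; split=> [w wB j _|w /(_ k I)]; last by rewrite eqxx.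
    by case: eqP => [->//|_].
move=> i j; rewrite ord1.
have := measurable_cfun_comp (measurable_of_coords 0 j) mc.
by congr measurable_cfun; apply/funext => w; rewrite /= real_coordsK.
Qed.

(* Keeping the sample point itself as the second variable, but only with the
   sigma-algebra of the other channels, makes the law of (w, X k0 w) a product. *)
Lemma decaying_negligible f (A : T -> 'M[R[i]]_M) : (0 < M)%N ->
  has_density P (X k0) f -> measurable_mxfun (A : TF -> 'M[R[i]]_M) ->
  (forall w, psdmx (A w)) ->
  P.-negligible [set w | decaying (X k0 w) (A w)].
Proof.
move=> M0 [_ mf f0 PXE] mA Ap.
pose XC := @real_coords R M \o X k0.
pose idF : {mfun T >-> TF} := HB.pack (id : T -> TF)
  (isMeasurableFun.Build _ _ _ _ (id : T -> TF) measurable_id_others).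
pose XF : {mfun T >-> ((M + M).-tuple (measurableTypeR R))} := HB.pack XC
  (isMeasurableFun.Build _ _ _ _ XC (mX k0)).
have mJ := measurable_fun_pair measurable_id_others (mX k0).
pose J : {mfun T >-> (TF * (M + M).-tuple (measurableTypeR R))%type} :=
  HB.pack (fun w : T => (w : TF, XC w)) (isMeasurableFun.Build _ _ _ _ _ mJ).
pose S : set (TF * (M + M).-tuple (measurableTypeR R)) :=
  [set p | decaying (of_coords p.2) (A p.1)].
have mS : measurable S.
  apply: (@measurable_decaying _ _ _ _ (fun p => of_coords p.2)
    (fun p : TF * (M + M).-tuple (measurableTypeR R) => A p.1)) => i j.
    exact: measurable_cfun_comp (measurable_of_coords i j) measurable_snd.
  exact: measurable_cfun_comp (mA i j) measurable_fst.
have SE : [set w | decaying (X k0 w) (A w)] = J @^-1` S.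
  by apply/seteqP; split=> w; rewrite /S /= real_coordsK.
exists (J @^-1` S); split; last by rewrite SE.
  by rewrite -[X in measurable X]setTI; exact: (mJ).
rewrite -[LHS]/(distribution P J S).
rewrite -(@product_measure_unique _ _ _ _ _ (distribution P idF)
  (distribution P XF) (distribution P J))//; last first.
  move=> B C mB mC.
  rewrite -[LHS]/(P (B `&` XC @^-1` C)) -[RHS]/(P B * P (XC @^-1` C))%E.
  by rewrite independent_of_others// muleC.
(* For fixed [w], the section lies in the hyperplane orthogonal to a top eigenvector of [A w], which
   is Lebesgue-null and hence null for a law with a density. *)
rewrite /product_measure1 integral0_eq// => w _.
have [e [u Au]] := psd_spectral_resolution (Ap w).
have [r0 top] := resolution_top M0 e.
have [N [mN N0 subN]] := lebesgue_tuple_ev (resolution_neq0 Au r0).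
rewrite /=; apply: (@subset_measure0 _ _ _ (distribution P XF) _ N) => //.
- exact: measurable_xsection.
- move=> t; rewrite /xsection /S /= inE /= => /(decayingP _ Au top) dec.
  by apply: subN; exact: dec.
- rewrite /distribution /pushforward -[LHS]/(P (XC @^-1` N)) PXE//.
  apply: null_set_integral => //; apply/measurable_EFinP.
  exact: measurable_funTS.
Qed.

End independence.

Lemma measurable_weighted_gram (R : realType) d (T : measurableType d) M
    (J : finType) (Q : pred J) (c : J -> R) (g : J -> T -> 'rV[R[i]]_M) :
  (forall j, measurable_mxfun (g j)) ->
  measurable_mxfun (fun w =>
    \sum_(j | Q j) (c j)%:C *: ((g j w)^t* *m g j w)).
Proof.
move=> mg; apply: measurable_mxfun_sum => j _; apply: measurable_mxfunZ.
by apply: measurable_mxfunM => //; exact: measurable_mxfun_adj.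
Qed.

Lemma psd_weighted_gram (R : realType) M (J : finType) (Q : pred J)
    (c : J -> R) (g : J -> 'rV[R[i]]_M) : (forall j, 0 <= c j) ->
  psdmx (\sum_(j | Q j) (c j)%:C *: ((g j)^t* *m g j)).
Proof. by move=> c0; apply: psd_sum => j _; exact: psd_gram. Qed.

(** The hypothesis [alpha_neq0] excludes [G = 0], for which the objective vanishes and every
    feasible point is optimal. *)
Theorem proposition3p2 (R : realType) (M KI KE : nat)
    (M_gt1 : (1 < M)%N) (KI_gt0 : (0 < KI)%N) (KE_gt0 : (0 < KE)%N)
    (Pmax zeta : R) (sigma2 gamma : 'I_KI -> R) (alpha : 'I_KE -> R)
    (Pmax_gt0 : 0 < Pmax)
    (sigma2_gt0 : forall i, 0 < sigma2 i)
    (gamma_gt0 : forall i, 0 < gamma i)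
    (alpha_ge0 : forall j, 0 <= alpha j)
    (alpha_neq0 : exists j, 0 < alpha j)
    (zeta_gt0 : 0 < zeta) (zeta_le1 : zeta <= 1)
    (d : measure_display) (T : measurableType d) (P : probability T R)
    (h : 'I_KI -> T -> 'rV[R[i]]_M) (g : 'I_KE -> T -> 'rV[R[i]]_M)
    (fh : 'I_KI -> (M + M).-tuple (measurableTypeR R) -> R)
    (fg : 'I_KE -> (M + M).-tuple (measurableTypeR R) -> R)
    (channels : channel_assumption P h g fh fg) :
  {ae P, forall w,
    let hw := fun i => h i w in
    let G := energy_matrix zeta alpha (fun j => g j w) in
    forall vE : 'cV[R[i]]_M, dominant_unit_eigenvector G vE ->
    sinr_feasible hw sigma2 gamma Pmax ->
    ~ aligned_feasible hw sigma2 gamma Pmax vE ->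
    forall (W : 'I_KI -> 'M[R[i]]_M) (WE : 'M[R[i]]_M),
    sdr2_optimal hw sigma2 gamma Pmax G W WE ->
    [/\ forall i, \rank (W i) = 1%N,
        (\rank WE <= 1)%N &
        exists q : R, [/\ 0 <= q, q <= Pmax &
                          WE = q%:C *: (vE *m vE^t*)]]}.
Proof.
case: channels => indep dh dg _.
set X := (X in mutually_independent P X) in indep.
have [j0 aj0] := alpha_neq0.
have M0 : (0 < M)%N by exact: ltnW.
have mX k : measurable_fun setT (@real_coords R M \o X k).
  by case: k => k; [case: (dh k)|case: (dg k)].
have za0 j : 0 <= zeta * alpha j by rewrite mulr_ge0// ltW.
have not_ae (B : set T) : P.-negligible B -> {ae P, forall w, ~ B w}.
  by move=> B0; change (P.-negligible (~` (~` B))); rewrite setCK.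
have aeg : {ae P, forall w, ~ decaying (g j0 w)
    (\sum_(j | j != j0) (zeta * alpha j)%:C *: ((g j w)^t* *m g j w))}.
  apply: not_ae; apply: (decaying_negligible mX indep (k0 := inr j0) M0 (dg j0)).
    (* The channel [j0], absent from the sum, is replaced by 0 so that the whole family is
       measurable for the sigma-algebra of the other channels. *)
    pose g' (j : 'I_KE) := if j == j0 then (fun=> 0) else g j.
    have := @measurable_weighted_gram R _
      (g_sigma_algebraType (other_events X (inr j0)))
      M _ (fun j => j != j0) (fun j => zeta * alpha j) g'.
    have -> : (fun w => \sum_(j | j != j0) (zeta * alpha j)%:C *:
        ((g' j w)^t* *m g' j w)) = (fun w => \sum_(j | j != j0)
        (zeta * alpha j)%:C *: ((g j w)^t* *m g j w)).
      apply/funext => w; apply: eq_bigr => j /negbTE jj0.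
      by rewrite /g' jj0.
    apply => j; rewrite /g'; case: eqP => [_ ? ?|/eqP jj0].
      by under eq_fun do rewrite mxE; exact: measurable_cfun_cst.
    by apply: (measurable_other_channel X (k := inr j)).
  by move=> w; exact: psd_weighted_gram.
have GE w : energy_matrix zeta alpha (fun j => g j w) =
    \sum_j (zeta * alpha j)%:C *: ((g j w)^t* *m g j w).
  rewrite /energy_matrix scaler_sumr; apply: eq_bigr => j _.
  by rewrite scalerA -rmorphM.
have aeh : {ae P, forall w, forall i, ~ decaying (h i w)
    (energy_matrix zeta alpha (fun j => g j w))}.
  apply: filter_forall => i; apply: not_ae.
  apply: (decaying_negligible mX indep (k0 := inl i) M0 (dh i)).
    under eq_fun do rewrite GE.
    apply: measurable_weighted_gram => j.
    exact: (measurable_other_channel X (k := inr j)).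
  by move=> w; rewrite GE; exact: psd_weighted_gram.
(* Both almost sure events involve only the channels, so a single null set serves all [vE], [W] and
   [WE]. *)
apply: filterS2 aeg aeh => w ndecg ndech /= vE domv _ naligned W WE opt.
exact: (sdr2_optimal_structure M_gt1 sigma2_gt0 gamma_gt0 alpha_ge0 aj0 zeta_gt0
  ndecg ndech domv naligned opt).
Qed.
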